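(* Let $M$ be a $\mathcal C^2$ compact Riemannian manifold of dimension $d$ without boundary, and let $X(\cdot)$ be a real-valued Gaussian random field on $M$ such that: the paths of $X(\cdot)$ are $\mathcal C^2$ almost surely; $\mathbb E[X(t)]=0$ and $\operatorname{Var}[X(t)]=1$ for every $t\in M$; and for every $t\in M$ the Gaussian vector $\nabla X(t)$ is non-degenerate. Fix $t\in M$, let $h$ be a nonzero vector of the tangent space at $t$, and for $\varepsilon\ne0$ let $s(\varepsilon):=\exp_t(\varepsilon h)\in M$, where $\exp_t$ is the Riemannian exponential map at $t$. Then, almost surely, $$\lim_{\varepsilon\to0,\ \varepsilon\ne0}X^{|t}(s(\varepsilon))=\frac{h^\top\tilde R(t)h}{h^\top\Lambda_2(t)h}=\frac{\tilde h^\top}{\|\tilde h\|_2}\,R(t)\,\frac{\tilde h}{\|\tilde h\|_2},\qquad \tilde h:=\Lambda_2^{1/2}(t)h .$$ Furthermore, almost surely, there exists a unit norm tangent vector $h_0$ at $t$ such that $$\limsup_{s\to t}X^{|t}(s)=h_0^\top R(t)h_0=\lambda_{\max}(R(t))<\infty ,$$ where $\lambda_{\max}(R(t))$ is the largest eigenvalue of $R(t)$.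
   Context: $c(s,t)=\mathbb E[X(s)X(t)]$ is the covariance function. $\nabla$ and $\nabla^2$ are the Riemannian gradient and Hessian (Levi-Civita connection); $\nabla_t c(s,t)$ is the Riemannian gradient of $t\mapsto c(s,t)$. Tangent vectors at $t$ and bilinear forms on $T_tM$ are represented as vectors and matrices in an orthonormal basis of $T_tM$. $\Lambda_2(t):=\operatorname{Var}[\nabla X(t)]$, which is invertible. For $s\ne t$ (with $c(s,t)<1$, which holds for all $s\neq t$ close enough to $t$), $$X^{|t}(s):=\frac{X(s)-c(s,t)X(t)-\nabla_t c(s,t)^\top\Lambda_2^{-1}(t)\nabla X(t)}{1-c(s,t)} .$$ $\tilde R(t)$ is the remainder of the Gaussian linear regression of $\nabla^2X(t)$ on $(X(t),\nabla X(t))$, i.e. $\nabla^2X(t)=-\Lambda_2(t)X(t)-\Lambda_3(t)\nabla X(t)+\tilde R(t)$, where $\Lambda_3(t)$ is the deterministic 3-way tensor given by the Gaussian regression formula, so that $\tilde R(t)$ is independent of $(X(t),\nabla X(t))$. $R(t):=\Lambda_2^{-1/2}(t)\tilde R(t)\Lambda_2^{-1/2}(t)$. In the $\limsup$, $s\to t$ with $s\ne t$. *)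

(* Defs.v *)
From HB Require Import structures.
From mathcomp Require Import all_boot all_order all_algebra.
From mathcomp Require Import all_classical all_reals all_analysis.
Set Implicit Arguments.
Unset Strict Implicit.
Unset Printing Implicit Defensive.
Import Order.TTheory GRing.Theory Num.Theory.
Import numFieldNormedType.Exports.
Local Open Scope classical_set_scope.
Local Open Scope ring_scope.

(* Vectors are row vectors: what is written u^T A u for a column vector u is
   quad A u, and A u is u *m A for a symmetric A. *)

Definition quad (R : realType) (d : nat) (A : 'M[R]_d) (u : 'rV[R]_d) : R :=
  (u *m A *m u^T) 0 0.

(* The library norm `|u| on matrices is the sup norm. *)
Definition norm2 (R : realType) (d : nat) (u : 'rV[R]_d) : R :=
  Num.sqrt (\sum_k u 0 k ^+ 2).

Definition psdmx (R : realType) (d : nat) (A : 'M[R]_d) : Prop :=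
  A^T = A /\ forall u, 0 <= quad A u.

(* A positive semidefinite matrix has exactly one positive semidefinite
   square root. *)
Definition sqrtmx (R : realType) (d : nat) (A : 'M[R]_d) : 'M[R]_d :=
  xget 0 [set S | psdmx S /\ S *m S = A].

Definition is_lambda_max (R : realType) (d : nat) (A : 'M[R]_d) (l : R) : Prop :=
  eigenvalue A l /\ forall l', eigenvalue A l' -> l' <= l.

Definition partial (R : realType) (d : nat) (V : normedModType R) (j : 'I_d)
    (f : 'rV[R]_d -> V) : 'rV[R]_d -> V :=
  'D_(delta_mx 0 j) f.

Definition C1_on (R : realType) (d : nat) (V : normedModType R)
    (U : set 'rV[R]_d) (f : 'rV[R]_d -> V) : Prop :=
  forall j x, U x ->
    derivable f x (delta_mx 0 j) /\ {for x, continuous (partial j f)}.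

Definition C2_on (R : realType) (d : nat) (V : normedModType R)
    (U : set 'rV[R]_d) (f : 'rV[R]_d -> V) : Prop :=
  C1_on U f /\ forall j, C1_on U (partial j f).

(* A C^2 atlas on M together with a Riemannian metric. The i-th chart is
   coord i : dom i -> coord i @` dom i, with inverse param i; both are total
   functions, meaningful only there. The metric in the i-th chart is the Gram
   matrix of the coordinate fields; on a C^2 manifold C^1 is the highest
   regularity of these coefficients preserved by changes of charts.
   The jacobian of the library acts on row vectors: df(v) = v *m 'J f x. *)
Record riemannian (R : realType) (d : nat) (M : topologicalType) := Riemannian {
  chart : Type;
  dom : chart -> set M;
  coord : chart -> M -> 'rV[R]_d;
  param : chart -> 'rV[R]_d -> M;
  metric : chart -> 'rV[R]_d -> 'M[R]_d;
  dom_cover : forall p, exists i, dom i p;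
  dom_open : forall i, open (dom i);
  img_open : forall i, open (coord i @` dom i);
  coordK : forall i p, dom i p -> param i (coord i p) = p;
  coord_continuous : forall i p, dom i p -> {for p, continuous (coord i)};
  param_continuous : forall i x, (coord i @` dom i) x ->
    {for x, continuous (param i)};
  transition_C2 : forall i j,
    C2_on (coord i @` (dom i `&` dom j)) (coord j \o param i);
  metric_C1 : forall i, C1_on (coord i @` dom i) (metric i);
  metric_sym : forall i x, (coord i @` dom i) x -> (metric i x)^T = metric i x;
  metric_pos : forall i x, (coord i @` dom i) x ->
    forall u, u != 0 -> 0 < quad (metric i x) u;
  metric_change : forall i j p, dom i p -> dom j p ->
    let J := 'J (coord j \o param i) (coord i p) in
    metric i (coord i p) = J *m metric j (coord j p) *m J^T
}.

Definition C2_map (R : realType) (d : nat) (M : topologicalType)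
    (A : riemannian R d M) (f : M -> R) : Prop :=
  forall i : chart A, C2_on (coord i @` dom i) (f \o param i : _ -> R^o).

(* christoffel i x k a b is the symbol \Gamma^k_{ab} of the Levi-Civita
   connection at the point of coordinates x in the i-th chart. *)
Definition christoffel (R : realType) (d : nat) (M : topologicalType)
    (A : riemannian R d M) (i : chart A) (x : 'rV[R]_d) (k a b : 'I_d) : R :=
  2^-1 * \sum_(l < d) invmx (metric i x) k l *
    (partial a (metric i) x l b + partial b (metric i) x l a
     - partial l (metric i) x a b).

Definition is_geodesic (R : realType) (d : nat) (M : topologicalType)
    (A : riemannian R d M) (g : R -> M) : Prop :=
  continuous g /\
  forall (i : chart A) (r : R), dom i (g r) ->
    let x : R -> 'rV[R]_d := coord i \o g in
    [/\ derivable x r 1,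
        derivable (derive1 x) r 1 &
        derive1 (derive1 x) r = \row_k
          - \sum_(a < d) \sum_(b < d)
              christoffel i (x r) k a b * derive1 x r 0 a * derive1 x r 0 b].

(* An orthonormal basis of the tangent space at p: row k of frame_mx holds
   the components of its k-th vector in the chart frame_chart. *)
Record frame (R : realType) (d : nat) (M : topologicalType)
    (A : riemannian R d M) (p : M) := Frame {
  frame_chart : chart A;
  frame_mx : 'M[R]_d;
  frame_dom : dom frame_chart p;
  frame_orthonormal :
    frame_mx *m metric frame_chart (coord frame_chart p) *m frame_mx^T = 1%:M
}.

(* e is the exponential map at p, a tangent vector being given by its
   components v in the frame F. The metric being C^1 only, geodesics with
   given initial data need not be unique, hence a predicate. *)
Definition is_exp_map (R : realType) (d : nat) (M : topologicalType)
    (A : riemannian R d M) (p : M) (F : frame A p) (e : 'rV[R]_d -> M) : Prop :=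
  forall v, let g := fun r : R => e (r *: v) in
    [/\ is_geodesic A g, g 0 = p &
        derive1 (coord (frame_chart F) \o g : R -> 'rV[R]_d) 0
          = v *m frame_mx F].

(* Components of the Riemannian gradient at p in the frame F: the k-th one is
   the derivative of f along the k-th vector of the frame. *)
Definition grad (R : realType) (d : nat) (M : topologicalType)
    (A : riemannian R d M) (p : M) (F : frame A p) (f : M -> R) : 'rV[R]_d :=
  let i := frame_chart F in
  \row_k 'D_(row k (frame_mx F)) (f \o param i : _ -> R^o) (coord i p).

Definition hess (R : realType) (d : nat) (M : topologicalType)
    (A : riemannian R d M) (p : M) (F : frame A p) (f : M -> R) : 'M[R]_d :=
  let i := frame_chart F in
  let fi : 'rV[R]_d -> R^o := f \o param i in
  let x := coord i p in
  frame_mx F *m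
    (\matrix_(a, b) (partial a (partial b fi) x
       - \sum_(k < d) christoffel i x k a b * partial k fi x))
  *m (frame_mx F)^T.

(* Constants count as Gaussian; they need a separate clause because
   normal_prob m 0 is not the Dirac mass at m. *)
Definition is_gaussian (R : realType) (dT : measure_display)
    (T : measurableType dT) (P : probability T R) (Y : T -> R) : Prop :=
  exists m s : R,
    (s != 0 /\ forall B, measurable B -> P (Y @^-1` B) = normal_prob m s B) \/
    (forall B, measurable B -> P (Y @^-1` B) = \d_m B).

Definition gaussian_field (R : realType) (dT : measure_display)
    (T : measurableType dT) (P : probability T R) (M : Type)
    (X : M -> {RV P >-> R}) : Prop :=
  forall (n : nat) (p : 'I_n -> M) (a : 'I_n -> R),
    is_gaussian P (fun w => \sum_(k < n) a k * X (p k) w).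

Definition covfun (R : realType) (dT : measure_display)
    (T : measurableType dT) (P : probability T R) (M : Type)
    (X : M -> {RV P >-> R}) (s t : M) : R :=
  fine 'E_P[fun w => X s w * X t w].

Definition crosscov (R : realType) (dT : measure_display)
    (T : measurableType dT) (P : probability T R) (m n : nat)
    (Y : T -> 'rV[R]_m) (Z : T -> 'rV[R]_n) : 'M[R]_(m, n) :=
  \matrix_(a, b) fine (covariance P (fun w => Y w 0 a) (fun w => Z w 0 b)).

(* Remainder of the linear regression of Y on Z, both centered. *)
Definition regression_remainder (R : realType) (dT : measure_display)
    (T : measurableType dT) (P : probability T R) (n : nat)
    (Y : T -> R) (Z : T -> 'rV[R]_n) (w : T) : R :=
  Y w - (crosscov P (fun w' => (Y w')%:M : 'rV[R]_1) Z
         *m invmx (crosscov P Z Z) *m (Z w)^T) 0 0.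

Definition gradX (R : realType) (dT : measure_display)
    (T : measurableType dT) (P : probability T R) (d : nat)
    (M : topologicalType) (A : riemannian R d M) (X : M -> {RV P >-> R})
    (t : M) (F : frame A t) (w : T) : 'rV[R]_d :=
  grad F (fun p => X p w).

Definition Lambda2 (R : realType) (dT : measure_display)
    (T : measurableType dT) (P : probability T R) (d : nat)
    (M : topologicalType) (A : riemannian R d M) (X : M -> {RV P >-> R})
    (t : M) (F : frame A t) : 'M[R]_d :=
  crosscov P (gradX X F) (gradX X F).

(* The field X^{|t}, for s != t such that c(s,t) < 1. *)
Definition Xbar (R : realType) (dT : measure_display)
    (T : measurableType dT) (P : probability T R) (d : nat)
    (M : topologicalType) (A : riemannian R d M) (X : M -> {RV P >-> R})
    (t : M) (F : frame A t) (s : M) (w : T) : R :=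
  (X s w - covfun X s t * X t w
   - (grad F (covfun X s) *m invmx (Lambda2 X F) *m (gradX X F w)^T) 0 0)
  / (1 - covfun X s t).

(* Entrywise regression of the Hessian on the vector (X(t), grad X(t)); the
   coefficients of X(t) and grad X(t) are the tensors - \Lambda_2(t) and
   - \Lambda_3(t). *)
Definition Rtilde (R : realType) (dT : measure_display)
    (T : measurableType dT) (P : probability T R) (d : nat)
    (M : topologicalType) (A : riemannian R d M) (X : M -> {RV P >-> R})
    (t : M) (F : frame A t) (w : T) : 'M[R]_d :=
  \matrix_(k, l) regression_remainder P
    (fun w' => hess F (fun p => X p w') k l)
    (fun w' => row_mx ((X t w')%:M : 'rV[R]_1) (gradX X F w')) w.

Definition Rmx (R : realType) (dT : measure_display)
    (T : measurableType dT) (P : probability T R) (d : nat)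
    (M : topologicalType) (A : riemannian R d M) (X : M -> {RV P >-> R})
    (t : M) (F : frame A t) (w : T) : 'M[R]_d :=
  let S := invmx (sqrtmx (Lambda2 X F)) in S *m Rtilde X F w *m S.

(* Main.v *)
Require Import Defs.
From mathcomp Require Import all_boot all_order all_algebra.
From mathcomp Require Import all_classical all_reals all_analysis.
From mathcomp Require Import measurable_realfun.
From mathcomp Require Import ring lra zify.
Set Implicit Arguments.
Unset Strict Implicit.
Unset Printing Implicit Defensive.
Import Order.TTheory GRing.Theory Num.Theory.
Import numFieldNormedType.Exports.
Local Open Scope classical_set_scope.
Local Open Scope ring_scope.

(** Read in the chart of the frame, the field is a random function [f] with
paths of class C^2, and both the numerator and the denominator of X^{|t} are of
second order in the displacement from [t]. The theorem comes from the
second-order terms of the two.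

Write f(x0 + v) = f(x0) + D(v) + Q(v) / 2 + r(v), the Taylor expansion of a
path: D(v) and Q(v) are the first and second derivatives along [v] and r(v) is
o(|v|^2), for each path separately ([taylor2]). The crucial point is that r(v)
is o(|v|^2) in mean square as well ([taylor_rem_L2]); no uniform integrability
is given, and it comes from the Gaussian law. The normalized remainder is a
limit, path by path, of linear combinations of values of the field, since
derivatives are limits of finite differences. A centred Gaussian variable that
stays below [e] in absolute value with probability more than one half has a
second moment at most 24 e^2 ([gaussian_var_controlled]), and this property
passes to pointwise limits by Fatou's lemma ([var_controlled_lim]). As the
normalized remainders tend to zero path by path, they are eventually
concentrated near zero, hence small in mean square ([var_controlled_cvg0]).

Covariances may thus be expanded term by term to second order
([ip_expansion]). Expanding the constant variance E[f(x0 + v)^2] = 1 gives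
E[f(x0) D(v)] = 0 and E[f(x0) Q(v)] = - E[D(v)^2] ([ip_dir_f0]). With Lambda
the covariance matrix of the gradient and [u] the components of [v] in the
frame, this yields
1 - c(s,t) = quad Lambda u / 2 + o(|u|^2) ([denominator_o2]).

For the numerator, let [regrem] map a square-integrable variable to its residual
in the regression on the field and its gradient at [t], which are uncorrelated.
The gradient of c(s, .) at [t] is the covariance of X(s) with the gradient at
[t], so the numerator of X^{|t}(s) is exactly the residual of X(s). The residual
is linear and kills f(x0) and D(v), so the numerator is half the residual of
Q(v), up to o(|v|^2) ([numerator_o2]). The Hessian differs from the matrix of
second partial derivatives by a combination of first derivatives, which the
residual kills too, so the residual of Q(v) is quad Rtilde u ([quad_Rtilde]).

Dividing, X^{|t}(s) - quad Rtilde u / quad Lambda u tends to 0 as s tends to [t]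
([ratio_near], [Xbar_near]). Along an exponential curve u / eps tends to [h], and
the ratio is homogeneous of degree 0: this is the first limit
([exp_map_limit]). With S the square root of Lambda ([psdmx_sqrt_exists]) and
y = u S the ratio is the value of the quadratic form of the matrix R(t) at
y / |y| ([quad_ratio]). Every direction occurs arbitrarily close to [t], so the
limsup is the maximum of that form on the unit sphere ([limsup_Xbar]), which is
the largest eigenvalue of R(t) ([exists_quad_max], [quad_max_lambda_max]).

The derivatives of the paths exist only almost surely and need not be measurable
as they stand. [chart_field] sets the field to zero on a measurable negligible
event outside of which the paths are C^2, and integrals are unaffected
([eq_integral_off_negligible]). *)

(** * Quadratic forms and the square root of a positive semidefinite matrix *)

Lemma cvgr_sum (R : realType) (T I : Type) (F : set_system T) {FF : Filter F}
    (s : seq I) (Q : pred I) (f : I -> T -> R) (l : I -> R) :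
  (forall i, Q i -> f i x @[x --> F] --> l i) ->
  \sum_(i <- s | Q i) f i x @[x --> F] --> \sum_(i <- s | Q i) l i.
Proof.
move=> fl; elim: s => [|i s IHs].
  rewrite big_nil; under eq_fun do rewrite big_nil; exact: cvg_cst.
rewrite big_cons; under eq_fun do rewrite big_cons.
by case: ifPn => // Qi; apply: (@cvgD _ R^o) => //; exact: fl.
Qed.

Section quadratic_forms.
Context {R : realType} {d : nat}.
Implicit Types (A B : 'M[R]_d) (u v w : 'rV[R]_d).

Definition bil A u v : R := (u *m A *m v^T) 0 0.

Lemma quadE A u : quad A u = bil A u u. Proof. by []. Qed.

Lemma bilDl A u v w : bil A (u + v) w = bil A u w + bil A v w.
Proof. by rewrite /bil !mulmxDl mxE. Qed.

Lemma bilDr A u v w : bil A u (v + w) = bil A u v + bil A u w.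
Proof. by rewrite /bil linearD mulmxDr mxE. Qed.

Lemma bilZl A k u v : bil A (k *: u) v = k * bil A u v.
Proof. by rewrite /bil -!scalemxAl mxE. Qed.

Lemma bilZr A k u v : bil A u (k *: v) = k * bil A u v.
Proof. by rewrite /bil linearZ -scalemxAr mxE. Qed.

Lemma bilBr A u v w : bil A u (v - w) = bil A u v - bil A u w.
Proof. by rewrite bilDr -scaleN1r bilZr mulN1r. Qed.

Lemma bil_mxD A B u v : bil (A + B) u v = bil A u v + bil B u v.
Proof. by rewrite /bil mulmxDr mulmxDl mxE. Qed.

Lemma bil_mxZ k A u v : bil (k *: A) u v = k * bil A u v.
Proof. by rewrite /bil -scalemxAr -scalemxAl mxE. Qed.

Lemma bilC A u v : A^T = A -> bil A u v = bil A v u.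
Proof.
move=> sA; have -> : bil A u v = (u *m A *m v^T)^T 0 0 by rewrite mxE.
by rewrite !trmx_mul trmxK sA mulmxA.
Qed.

Lemma bilE A u v : bil A u v = \sum_i \sum_j u 0 i * A i j * v 0 j.
Proof.
rewrite /bil mxE exchange_big/=; apply: eq_bigr => j _.
by rewrite mxE mulr_suml; apply: eq_bigr => i _; rewrite mxE.
Qed.

Lemma quad_conj A B u : quad (B *m A *m B^T) u = quad A (u *m B).
Proof. by rewrite /quad trmx_mul !mulmxA. Qed.

Lemma bil1E u v : bil 1%:M u v = \sum_k u 0 k * v 0 k.
Proof. by rewrite /bil mulmx1 mxE; apply: eq_bigr => k _; rewrite mxE. Qed.

Lemma norm2_sqr u : norm2 u ^+ 2 = quad 1%:M u.
Proof.
rewrite /norm2 sqr_sqrtr ?sumr_ge0//; last by move=> *; exact: sqr_ge0.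
by rewrite quadE bil1E; apply: eq_bigr => k _; rewrite expr2.
Qed.

Lemma norm2_ge0 u : 0 <= norm2 u. Proof. exact: sqrtr_ge0. Qed.

Lemma quadZ A k u : quad A (k *: u) = k ^+ 2 * quad A u.
Proof. by rewrite !quadE bilZl bilZr mulrA expr2. Qed.

Lemma quad0 A : quad A 0 = 0.
Proof. by rewrite -(scale0r 0) quadZ expr0n mul0r. Qed.

Lemma norm2_eq0 u : (norm2 u == 0) = (u == 0).
Proof.
rewrite -sqrf_eq0 norm2_sqr quadE bil1E psumr_eq0 => [|k _]; last first.
  by rewrite -expr2 sqr_ge0.
apply/allP/eqP => [u0|-> k _]; last by rewrite mxE mul0r eqxx.
apply/rowP => k; rewrite mxE; apply/eqP.
by have := u0 k (mem_index_enum k); rewrite /= -expr2 sqrf_eq0.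
Qed.

Lemma norm2_gt0 u : (0 < norm2 u) = (u != 0).
Proof. by rewrite lt_def norm2_ge0 andbT norm2_eq0. Qed.

Lemma norm2Z k u : norm2 (k *: u) = `|k| * norm2 u.
Proof.
apply/eqP; rewrite -(@eqrXn2 _ 2)// ?norm2_ge0 ?mulr_ge0 ?norm2_ge0//.
by rewrite exprMn !norm2_sqr quadZ real_normK ?num_real.
Qed.

Lemma norm2_normalize u : u != 0 -> norm2 ((norm2 u)^-1 *: u) = 1.
Proof.
move=> u0; rewrite norm2Z ger0_norm ?invr_ge0 ?norm2_ge0// mulVf//.
by rewrite norm2_eq0.
Qed.

Lemma row_eq0P w : (forall v, bil 1%:M w v = 0) -> w = 0.
Proof.
move=> /(_ w); rewrite -quadE -norm2_sqr => /eqP.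
by rewrite sqrf_eq0 norm2_eq0 => /eqP.
Qed.

Lemma coord_le_norm u k : `|u 0 k| <= `|u|.
Proof.
rewrite [leRHS]/Num.Def.normr/= mx_normrE.
by apply/bigmax_geP; right; exists (0, k).
Qed.

Lemma norm_le_norm2 u : `|u| <= norm2 u.
Proof.
rewrite [leLHS]/Num.Def.normr/= mx_normrE; apply/bigmax_leP; split => [|[i k] _ /=].
  exact: norm2_ge0.
rewrite (ord1 i) -ler_sqr ?nnegrE ?norm2_ge0// real_normK ?num_real//.
rewrite norm2_sqr quadE bil1E (bigD1 k)//= -expr2 lerDl.
by apply: sumr_ge0 => j _; rewrite -expr2 sqr_ge0.
Qed.

Lemma continuous_bil A : continuous (fun u => bil A u u : R^o).
Proof.
move=> u; rewrite (_ : (fun _ => _) = fun u : 'rV[R]_d =>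
    \sum_i \sum_j u 0 i * A i j * u 0 j); last first.
  by apply/funext => v; rewrite bilE.
have cc k : (v 0 k : R^o) @[v --> u] --> (u 0 k : R^o).
  exact: coord_continuous.
apply: (@cvgr_sum _ _ _ (nbhs u)) => i _; apply: (@cvgr_sum _ _ _ (nbhs u)) => j _.
by apply: cvgM; [apply: cvgM; [exact: cc|exact: cvg_cst]|exact: cc].
Qed.

(** The unit sphere is compact, and homogeneity extends the bound from the
sphere to every vector. *)
Lemma exists_quad_max A : (0 < d)%N ->
  exists2 h0, norm2 h0 = 1 & forall u, quad A u <= quad A h0 * norm2 u ^+ 2.
Proof.
move=> d0; pose S := [set u : 'rV[R]_d | quad 1%:M u = 1].
have S0 : S !=set0.
  exists (delta_mx 0 (Ordinal d0)).
  rewrite /S/= quadE bil1E (bigD1 (Ordinal d0))//= big1 ?addr0 => [|k /negPf kn].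
    by rewrite !mxE !eqxx mulr1.
  by rewrite !mxE kn mulr0.
have cS : compact S.
  apply: bounded_closed_compact.
    exists 1; split; first exact: num_real.
    move=> x x1 u /= u1; apply: (le_trans (norm_le_norm2 u)).
    rewrite -ler_sqr ?nnegrE ?norm2_ge0 ?(le_trans _ (ltW x1))//.
    by rewrite norm2_sqr u1 -[leLHS](expr1n _ 2) lerXn2r ?nnegrE ?ler01 ?(le_trans _ (ltW x1))// ltW.
  have := @closed_comp _ _ (fun u => bil 1%:M u u : R^o) [set 1].
  by apply; [move=> ? _; exact: continuous_bil|exact: closed_eq].
have [h0 /[!inE] Sh0 maxh0] := EVT_max_rV S0 cS
  (continuous_subspaceT (@continuous_bil A)).
have h01 : norm2 h0 = 1.
  by apply/eqP; rewrite -(@eqrXn2 _ 2)// ?norm2_ge0// norm2_sqr expr1n; apply/eqP.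
exists h0 => // u; have [->|u0] := eqVneq u 0.
  by rewrite norm2_sqr !quad0 mulr0.
have /maxh0 : ((norm2 u)^-1 *: u) \in S.
  by rewrite inE /S/= -norm2_sqr norm2_normalize// expr1n.
rewrite -!quadE quadZ exprVn mulrC ler_pdivrMr// exprn_gt0//.
by rewrite norm2_gt0.
Qed.

(** First-order condition at the maximum: every tangential perturbation of
[h0] changes the Rayleigh quotient only to second order, so [h0 *m A] is
orthogonal to the tangent space of the sphere. *)
Lemma quad_max_eigen A h0 : A^T = A -> norm2 h0 = 1 ->
  (forall u, quad A u <= quad A h0 * norm2 u ^+ 2) -> h0 *m A = quad A h0 *: h0.
Proof.
move=> sA h01 maxh0; apply/eqP; rewrite -subr_eq0; apply/eqP/row_eq0P => v.
set l := quad A h0; set b := bil _ _ _.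
pose g := l * quad 1%:M v - quad A v.
have bE : b = bil A h0 v - l * bil 1%:M h0 v.
  by rewrite /b /bil mulmx1 mulmxBl mxE mulmx1 -scalemxAl !mxE.
have tb t : 2 * t * b <= t ^+ 2 * g.
  have := maxh0 (h0 + t *: v); rewrite norm2_sqr.
  rewrite !quadE !(bilDl, bilDr, bilZl, bilZr) (bilC v h0 sA).
  rewrite (bilC v h0 (trmx1 _ _)) -!quadE -(norm2_sqr h0) h01.
  rewrite /g bE -/l; lra.
apply/eqP; rewrite -sqrf_eq0 eq_le sqr_ge0 andbT leNgt; apply/negP => b2.
have g0 : 0 < g ^+ 2 + 1 by rewrite ltr_wpDl ?sqr_ge0.
pose k := (g ^+ 2 + 1)^-1; have k0 : 0 < k by rewrite invr_gt0.
have kg : k * (g ^+ 2 + 1) = 1 by rewrite mulVf ?gt_eqF.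
have : k * b ^+ 2 * 2 <= k * b ^+ 2 * (k * g) by have := tb (b * k); lra.
rewrite (ler_pM2l (mulr_gt0 k0 b2)) => /(ler_wpM2l (ltW g0)).
rewrite mulrA [_ * k]mulrC kg mul1r; nra.
Qed.

(** A maximizer on the sphere is an eigenvector, and a unit eigenvector for [l]
gives the form the value [l]. *)
Lemma quad_max_lambda_max A h0 : A^T = A -> norm2 h0 = 1 ->
  (forall u, quad A u <= quad A h0 * norm2 u ^+ 2) ->
  is_lambda_max A (quad A h0).
Proof.
move=> sA h01 maxh0; split.
  apply/eigenvalueP; exists h0; first exact: quad_max_eigen.
  by rewrite -norm2_eq0 h01 oner_eq0.
move=> l /eigenvalueP[v vA v0]; have := maxh0 v.
rewrite {1}/quad vA -scalemxAl mxE.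
have -> : (v *m v^T) 0 0 = norm2 v ^+ 2 by rewrite norm2_sqr /quad mulmx1.
by rewrite ler_pM2r// exprn_gt0// norm2_gt0.
Qed.

(** The proof deflates [A]: a unit vector [h0] maximizing [quad A] is an
eigenvector, subtracting [quad A h0 *: h0^T *m h0] lowers the rank, and the
square root of the difference is orthogonal to [h0]. *)
Lemma psdmx_sqrt_exists A : psdmx A -> exists S, psdmx S /\ S *m S = A.
Proof.
have [n] := ubnP (\rank A); elim: n A => // n IHn A rkA psdA.
have [sA A0] := psdA.
have [->|Aneq0] := eqVneq A 0.
  exists 0; split; last by rewrite mulmx0.
  by split=> [|u]; [rewrite trmx0|rewrite /quad mulmx0 mul0mx mxE].
have d0 : (0 < d)%N.
  by case: (posnP d) Aneq0 => // d0; rewrite -mxrank_eq0 -leqn0 (leq_trans (rank_leq_row A))// d0.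
have [h0 h01 maxh0] := exists_quad_max A d0.
have hA := quad_max_eigen sA h01 maxh0; set l := quad A h0 in maxh0 hA.
have l_ge0 : 0 <= l by exact: A0.
have l_gt0 : 0 < l.
  rewrite lt_def l_ge0 andbT; apply: contra_neq Aneq0 => l0.
  have q0 u : quad A u = 0.
    by apply/eqP; rewrite eq_le A0 andbT -[leRHS](mul0r (norm2 u ^+ 2)) -l0 maxh0.
  apply/row_matrixP => i; rewrite row0; apply: row_eq0P => v.
  have /eqP := q0 (delta_mx 0 i + v).
  rewrite quadE !(bilDl, bilDr) -!quadE !q0 add0r addr0 (bilC v _ sA).
  by rewrite -mulr2n mulrn_eq0/= rowE /bil mulmx1 => /eqP.
pose H := h0^T *m h0.
have hh : h0 *m h0^T = 1%:M.
  by apply/matrixP => i j; rewrite !ord1 [RHS]mxE eqxx -[RHS](expr1n R 2) -h01 norm2_sqr /quad mulmx1.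
have HH : H *m H = H by rewrite /H mulmxA -[_ *m h0^T]mulmxA hh mulmx1.
have sH : H^T = H by rewrite /H trmx_mul trmxK.
have qH u : quad H u = bil 1%:M u h0 ^+ 2.
  rewrite /quad /H mulmxA -mulmxA [X in (_ *m X) 0 0](_ : _ = (bil 1%:M u h0)%:M).
    by rewrite mul_mx_scalar mxE expr2 /bil mulmx1.
  by apply/matrixP => i j; rewrite !ord1 [RHS]mxE bilC ?trmx1// /bil mulmx1.
have AH : A *m H = l *: H.
  rewrite /H mulmxA; have -> : A *m h0^T = l *: h0^T.
    by rewrite -[A in LHS]sA -trmx_mul hA linearZ.
  by rewrite scalemxAl.
pose B : 'M[R]_d := A - l *: H.
have hB : h0 *m B = 0.
  by rewrite mulmxBr hA -scalemxAr /H mulmxA hh mul1mx subrr.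
have sB : B^T = B by rewrite /B linearB linearZ/= sA sH.
have psdB : psdmx B.
  split=> // u.
  have [a [w [-> wh]]] : exists a w, u = a *: h0 + w /\ bil 1%:M w h0 = 0.
    exists (bil 1%:M u h0), (u - bil 1%:M u h0 *: h0); split.
      by rewrite addrC subrK.
    by rewrite bilDl -scaleNr bilZl -quadE -norm2_sqr h01 expr1n mulr1 subrr.
  suff -> : quad B (a *: h0 + w) = quad A w by exact: A0.
  have bilBh v : bil B h0 v = 0 by rewrite /bil hB mul0mx mxE.
  rewrite quadE !(bilDl, bilDr, bilZl, bilZr) (bilC w h0 sB) !bilBh.
  rewrite !mulr0 !add0r {1}/B bil_mxD -scaleNr bil_mxZ -!quadE qH wh.
  by rewrite expr0n/= !mulr0 add0r addr0.
have rkB : (\rank B < n)%N.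
  rewrite -ltnS (leq_trans _ rkA)// ltnS.
  have kB : (kermx A + h0 <= kermx B)%MS.
    rewrite addsmx_sub; apply/andP; split; apply/sub_kermxP => //.
    have kA : kermx A *m A = 0 by exact: mulmx_ker.
    rewrite mulmxBr kA -scalemxAr.
    have /eqP : kermx A *m (l *: H) = 0 by rewrite -AH mulmxA kA mul0mx.
    rewrite -scalemxAr scaler_eq0 gt_eqF//= => /eqP ->.
    by rewrite scaler0 subrr.
  have kAh : (kermx A :&: h0 = 0)%MS.
    apply/eqP; rewrite -submx0; apply/rV_subP => v.
    rewrite sub_capmx => /andP[/sub_kermxP vA /sub_rVP[k vk]].
    move: vA; rewrite vk -scalemxAl hA => /eqP.
    rewrite !scaler_eq0 => /orP[/eqP->|]; first by rewrite scale0r sub0mx.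
    by rewrite gt_eqF//= => /eqP->; rewrite scaler0 sub0mx.
  have := mxrankS kB; rewrite mxrank_disjoint_sum// !mxrank_ker rank_rV.
  have -> : h0 != 0 by rewrite -norm2_eq0 h01 oner_eq0.
  have := rank_leq_row A; have := rank_leq_row B; lia.
have [S [[sS S0] SS]] := IHn B rkB psdB.
have hS : h0 *m S = 0.
  apply/eqP; rewrite -norm2_eq0 -sqrf_eq0 norm2_sqr /quad mulmx1 trmx_mul sS.
  by rewrite mulmxA -[h0 *m S *m S]mulmxA SS hB mul0mx mxE.
have Sh : S *m h0^T = 0 by rewrite -[S]sS -trmx_mul hS trmx0.
exists (S + Num.sqrt l *: H); split; first split.
- by rewrite linearD linearZ/= sS sH.
- move=> u; rewrite quadE bil_mxD bil_mxZ -!quadE addr_ge0// qH.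
  by rewrite mulr_ge0 ?sqrtr_ge0 ?sqr_ge0.
- rewrite mulmxDl !mulmxDr SS -!scalemxAr -!scalemxAl HH.
  rewrite {1}/H mulmxA Sh mul0mx scaler0 addr0 {1}/H -mulmxA hS mulmx0 scaler0.
  by rewrite add0r scalerA -expr2 sqr_sqrtr// /B subrK.
Qed.

(** Existence of a square root is what makes the choice in [sqrtmx] meaningful. *)
Lemma sqrtmxP A : psdmx A -> psdmx (sqrtmx A) /\ sqrtmx A *m sqrtmx A = A.
Proof. by move=> /psdmx_sqrt_exists[S SA]; rewrite /sqrtmx; case: xgetP => [? _ //|/(_ S)[]]. Qed.

End quadratic_forms.

(** * Taylor expansion of C^2 functions given by their partial derivatives *)

Section taylor.
Context {R : realType} {d : nat}.
Implicit Types (U : set 'rV[R]_d) (f : 'rV[R]_d -> R^o) (x v : 'rV[R]_d).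

(** All remainder estimates below compare the two ends of a segment through
this bound; [psi] is [f] along the segment minus its candidate expansion. *)
Lemma mean_value_le (psi dpsi : R -> R^o) (C : R) :
  (forall s : R, 0 <= s <= 1 -> is_derive s (1 : R) psi (dpsi s)) ->
  (forall s : R, 0 <= s <= 1 -> `|dpsi s| <= C) -> `|psi 1 - psi 0| <= C.
Proof.
move=> der bnd.
have [c c01 ->] : exists2 c : R, c \in `[0, 1] & psi 1 - psi 0 = dpsi c * (1 - 0).
  apply: MVT_segment => //.
    by move=> s; rewrite in_itv/= => /andP[s0 s1]; apply: der; rewrite !ltW.
  apply: derivable_within_continuous => s; rewrite in_itv/= => s01.
  by have [] := der s s01.
by rewrite subr0 mulr1; apply: bnd; rewrite in_itv/= in c01.
Qed.

Lemma is_derive_line f z w (s : R) : derivable f (z + s *: w) w ->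
  is_derive s (1 : R) (fun r : R => f (z + r *: w)) ('D_w f (z + s *: w)).
Proof.
have E : (fun h : R => h^-1 *: (((fun r : R => f (z + r *: w)) \o shift s) (h *: 1)
    - f (z + s *: w))) =
  (fun h => h^-1 *: ((f \o shift (z + s *: w)) (h *: w) - f (z + s *: w))).
  apply/funext => h /=; congr (_ *: (f _ - _)).
  transitivity (z + (h + s) *: w).
    by congr (_ + (_ + _) *: _); exact: mulr1.
  by rewrite scalerDl addrCA.
by move=> df; split; rewrite /derivable /derive E.
Qed.

Lemma norm_delta_le (k : 'I_d) : `|delta_mx 0 k : 'rV[R]_d| <= 1.
Proof.
change (mx_norm (delta_mx 0 k : 'rV[R]_d) <= 1); rewrite mx_normrE.
apply/bigmax_leP; split => // -[i j] _.
by rewrite mxE/=; case: (_ && _); rewrite /= ?normr1 ?normr0.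
Qed.

Definition gradv f x : 'rV[R]_d := \row_k partial k f x.
Definition hessm f x : 'M[R]_d := \matrix_(a, b) partial a (partial b f) x.

(** Uniformity in the base point [z] is what allows the increments along
successive coordinates, whose base points differ, to be added up in [taylor1]. *)
Lemma coordinate_increment U f x (e : R) : open U -> C1_on U f -> U x -> 0 < e ->
  exists2 del : R, 0 < del & forall z (t : R) k, `|z - x| < del ->
    `|z + t *: delta_mx 0 k - x| < del ->
    `|f (z + t *: delta_mx 0 k) - f z - t * partial k f x| <= e * `|t|.
Proof.
move=> oU fC1 Ux e0.
have near_x : \forall y \near x, U y /\
    forall k, `|partial k f y - partial k f x| <= e.
  have near_k : \forall y \near x, forall k : 'I_d,
      `|partial k f x - partial k f y| <= e.
    apply: (@filter_forall _ _ _ (nbhs x)) => k.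
    by have [_ /cvgrPdist_le/(_ e e0)] := fC1 k x Ux.
  near=> y; split; first by near: y; exact: open_nbhs_nbhs.
  by move=> k; rewrite distrC; move: k; near: y.
have [del /= del0 delP] := (nbhs_ballP _ _).1 near_x.
exists del => // z t k zx ztx.
pose psi (s : R) : R^o := f (z + (s * t) *: delta_mx 0 k) - s * (t * partial k f x).
have Us (s : R) : 0 <= s <= 1 -> ball x del (z + (s * t) *: delta_mx 0 k).
  move=> /andP[s0 s1]; rewrite -ball_normE/= distrC.
  have -> : z + (s * t) *: delta_mx 0 k - x =
      (1 - s) *: (z - x) + s *: (z + t *: delta_mx 0 k - x).
    by apply/rowP => j; rewrite !mxE; ring.
  rewrite (le_lt_trans (ler_normD _ _))// !normrZ ger0_norm ?subr_ge0//.
  rewrite ger0_norm//.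
  set a := `|_|; set b := `|_ - x|; pose m := Num.max a b.
  have mdel : m < del by rewrite gt_max; apply/andP; split.
  have am : (1 - s) * a <= (1 - s) * m.
    by rewrite ler_wpM2l ?subr_ge0// le_max lexx.
  have bm : s * b <= s * m by rewrite ler_wpM2l// le_max lexx orbT.
  by apply: le_lt_trans mdel; lra.
have dpsi (s : R) : 0 <= s <= 1 ->
    is_derive s (1 : R) psi
      (t * (partial k f (z + (s * t) *: delta_mx 0 k) - partial k f x)).
  move=> s01; have [Uzs _] := delP _ (Us s s01).
  have [dk _] := fC1 k _ Uzs.
  have dl := is_derive_line dk.
  have dm : is_derive s (1 : R) (fun r : R => r * t : R^o) t.
    by apply: is_derive_eq; rewrite scaler0 add0r [LHS]mulr1.
  have := @is_derive1_comp R (fun r : R => f (z + r *: delta_mx 0 k))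
    (fun r : R => r * t) s _ _ dl dm.
  move=> dc.
  have dn : is_derive s (1 : R) (fun r : R => r * (t * partial k f x) : R^o) (t * partial k f x).
    by apply: is_derive_eq; rewrite scaler0 add0r [LHS]mulr1.
  apply: (is_derive_eq (is_deriveB dc dn)).
  by rewrite /partial; ring.
have := mean_value_le dpsi (C := e * `|t|).
rewrite /psi !mul1r !mul0r subr0 scale0r addr0.
have -> : f (z + t *: delta_mx 0 k) - t * partial k f x - f z =
  f (z + t *: delta_mx 0 k) - f z - t * partial k f x by ring.
apply => s s01; rewrite normrM mulrC ler_wpM2r//.
by have [_] := delP _ (Us s s01); apply.
Unshelve. all: by end_near. Qed.

Let prefix v (k : nat) : 'rV[R]_d := \row_j (if (j < k)%N then v 0 j else 0).

Let prefixS v (k : 'I_d) :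
  prefix v k.+1 = prefix v k + v 0 k *: delta_mx 0 k.
Proof.
apply/rowP => j; rewrite !mxE eqxx/= ltnS leq_eqVlt -val_eqE/=.
have [jk|jk|/val_inj ->] := ltngtP; rewrite /= ?mulr0 ?addr0//.
by rewrite add0r mulr1.
Qed.

Let norm_prefix_le v k : `|prefix v k| <= `|v|.
Proof.
change (mx_norm (prefix v k) <= `|v|); rewrite mx_normrE.
apply/bigmax_leP; split => // -[i j] _; rewrite mxE/=.
by case: ifP => _; rewrite ?normr0// coord_le_norm.
Qed.

(** Going from [x] to [x + v] one coordinate at a time, each increment is
controlled by the mean value theorem and the continuity of one partial
derivative; this is why partial derivatives suffice. *)
Lemma taylor1 U f x (e : R) : open U -> C1_on U f -> U x -> 0 < e ->
  exists2 del : R, 0 < del & forall v, `|v| < del ->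
    `|f (x + v) - f x - bil 1%:M v (gradv f x)| <= e * `|v|.
Proof.
move=> oU fC1 Ux e0; have d0 : 0 < d.+1%:R :> R by [].
have [del del0 delP] := coordinate_increment oU fC1 Ux (divr_gt0 e0 d0).
exists del => // v vdel.
have prefixd : prefix v d = v by apply/rowP => j; rewrite mxE ltn_ord.
have prefix0 : prefix v 0 = 0 by apply/rowP => j; rewrite !mxE.
have -> : f (x + v) - f x - bil 1%:M v (gradv f x) = \sum_(k < d)
    (f (x + prefix v k.+1) - f (x + prefix v k) - v 0 k * partial k f x).
  rewrite sumrB bil1E; congr (_ - _); last by apply: eq_bigr => k _; rewrite mxE.
  rewrite -(big_mkord xpredT (fun k => f (x + prefix v k.+1) - f (x + prefix v k))).
  by rewrite telescope_sumr// prefixd prefix0 addr0.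
rewrite (le_trans (ler_norm_sum _ _ _))//.
rewrite (@le_trans _ _ (\sum_(k < d) e / d.+1%:R * `|v|))//.
  apply: ler_sum => k _; rewrite prefixS addrA.
  apply: (le_trans (delP _ _ _ _ _)).
  - by rewrite addrAC subrr add0r (le_lt_trans (norm_prefix_le _ _)).
  - rewrite -[x + _ + _]addrA -prefixS addrAC subrr add0r.
    by rewrite (le_lt_trans (norm_prefix_le _ _)).
  - by apply: ler_wpM2l; [rewrite divr_ge0 ?ltW|exact: coord_le_norm].
rewrite sumr_const card_ord -mulrnAl ler_wpM2r// -mulr_natr -mulrA.
by rewrite ler_piMr ?(ltW e0)// mulrC ler_pdivrMr// mul1r ler_nat.
Qed.

Lemma C1_is_derive U f x v : open U -> C1_on U f -> U x ->
  is_derive x v f (bil 1%:M v (gradv f x)).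
Proof.
move=> oU fC1 Ux.
suff cv : h^-1 *: ((f \o shift x) (h *: v) - f x) @[h --> (0 : R)^']
    --> bil 1%:M v (gradv f x).
  by split; [apply/cvg_ex; exists (bil 1%:M v (gradv f x))|exact: cvg_lim].
apply/cvgrPdist_le => e e0.
have v0 : 0 < `|v| + 1 by rewrite ltr_wpDl.
have [del del0 delP] := taylor1 oU fC1 Ux (divr_gt0 e0 v0).
near=> h => /=; have h0 : h != 0 by near: h; exact: nbhs_dnbhs_neq.
have hdel : `|h *: v| < del.
  rewrite normrZ (@le_lt_trans _ _ (`|h| * (`|v| + 1)))//.
    by rewrite ler_wpM2l// lerDl.
  rewrite -ltr_pdivlMr//; near: h; apply: dnbhs0_lt.
  exact: divr_gt0.
rewrite [leLHS](_ : _ = `|h|^-1 *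
    `|f (x + h *: v) - f x - bil 1%:M (h *: v) (gradv f x)|); last first.
  rewrite -normfV -normrM distrC bilZl; congr `|_|.
  rewrite [x + _]addrC mulrBr mulKf//.
have /(ler_wpM2l (ltW _ : 0 <= `|h|^-1)) := delP _ hdel.
move=> /(_ _)/le_trans; apply; first by rewrite invr_gt0 normr_gt0.
rewrite normrZ mulrCA mulKf ?normr_eq0// -mulrA ler_piMr ?(ltW e0)//.
by rewrite mulrC ler_pdivrMr// mul1r lerDl.
Unshelve. all: by end_near. Qed.

Lemma C1_line U f (z w : 'rV[R]_d) (s : R) : open U -> C1_on U f ->
  U (z + s *: w) ->
  is_derive s (1 : R) (fun r : R => f (z + r *: w))
    (bil 1%:M w (gradv f (z + s *: w))).
Proof.
move=> oU fC1 Us; have [df <-] := C1_is_derive w oU fC1 Us.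
exact: is_derive_line.
Qed.

Lemma taylor1_grad U f x (e : R) : open U -> C2_on U f -> U x -> 0 < e ->
  exists2 del : R, 0 < del & forall v, `|v| < del -> forall b,
    `|partial b f (x + v) - partial b f x - (v *m hessm f x) 0 b| <= e * `|v|.
Proof.
move=> oU [_ fC2] Ux e0; apply/nbhs_norm0P.
suff near_b b : \forall v \near (0 : 'rV[R]_d),
    `|partial b f (x + v) - partial b f x - (v *m hessm f x) 0 b| <= e * `|v|.
  exact: (@filter_forall _ _ _ (nbhs (0 : 'rV[R]_d))).
apply/nbhs_norm0P.
have [del del0 delP] := taylor1 oU (fC2 b) Ux e0.
exists del => // v /delP; congr (`|_ - _| <= _).
by rewrite bil1E mxE; apply: eq_bigr => k _; rewrite !mxE.
Qed.

Lemma open_nbhs0 U x : open U -> U x ->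
  exists2 del : R, 0 < del & forall v, `|v| < del -> U (x + v).
Proof.
move=> oU Ux.
have [del /= del0 delP] := (nbhs_ballP _ _).1 (open_nbhs_nbhs (conj oU Ux)).
exists del => // v vdel; apply: delP; rewrite -ball_normE/=.
by rewrite opprD addrA subrr add0r normrN.
Qed.

Lemma bil1_le (u v : 'rV[R]_d) (C : R) : (forall k, `|v 0 k| <= C) ->
  `|bil 1%:M u v| <= d%:R * C * `|u|.
Proof.
move=> vC; rewrite bil1E (le_trans (ler_norm_sum _ _ _))//.
rewrite (@le_trans _ _ (\sum_(k < d) C * `|u|))//.
  by apply: ler_sum => k _; rewrite normrM mulrC ler_pM// coord_le_norm.
by rewrite sumr_const card_ord -mulrA mulr_natl.
Qed.

(** The derivative along the segment from [x] to [x + v] of the remainder is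
controlled by the first-order expansion of the gradient at [x]. *)
Lemma taylor2 U f x (e : R) : open U -> C2_on U f -> U x -> 0 < e ->
  exists2 del : R, 0 < del & forall v, `|v| < del ->
    `|f (x + v) - f x - bil 1%:M v (gradv f x) - 2^-1 * quad (hessm f x) v|
      <= e * `|v| ^+ 2.
Proof.
move=> oU fC2 Ux e0; have d0 : 0 < d.+1%:R :> R by [].
have [del1 del10 del1P] := taylor1_grad oU fC2 Ux (divr_gt0 e0 d0).
have [del2 del20 del2P] := open_nbhs0 oU Ux.
exists (Num.min del1 del2); first by rewrite lt_min del10.
move=> v; rewrite lt_min => /andP[v1 v2].
pose psi (s : R) : R^o := f (x + s *: v) - s * bil 1%:M v (gradv f x)
   - 2^-1 * s ^+ 2 * quad (hessm f x) v.
have sv (s : R) : 0 <= s <= 1 -> `|s *: v| <= `|v|.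
  by move=> /andP[s0 s1]; rewrite normrZ ger0_norm// ler_piMl.
have dpsi (s : R) : 0 <= s <= 1 -> is_derive s (1 : R) psi
    (bil 1%:M v (gradv f (x + s *: v) - gradv f x - s *: (v *m hessm f x))).
  move=> s01.
  have dl := C1_line oU fC2.1 (del2P _ (le_lt_trans (sv _ s01) v2)).
  have dm : is_derive s (1 : R)
      (fun r : R => r * bil 1%:M v (gradv f x) : R^o) (bil 1%:M v (gradv f x)).
    by apply: is_derive_eq; rewrite scaler0 add0r [LHS]mulr1.
  have dq : is_derive s (1 : R)
      (fun r : R => 2^-1 * r ^+ 2 * quad (hessm f x) v : R^o)
      (s * quad (hessm f x) v).
    apply: is_derive_eq; rewrite !scaler0 !add0r /GRing.scale/=.
    by rewrite ?addr0; lra.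
  apply: (is_derive_eq (is_deriveB (is_deriveB dl dm) dq)).
  rewrite !bilBr bilZr; congr (_ - _ - _ * _).
  by rewrite quadE {1}bilC ?trmx1// /bil mulmx1.
have := mean_value_le dpsi (C := e * `|v| ^+ 2).
rewrite /psi !mul1r !mul0r !subr0 !scale1r !scale0r addr0 expr1n mulr1.
rewrite expr0n/= !mulr0 mul0r !subr0.
set a := f (x + v); set b := f x; set c := bil _ _ _; set q := _ * quad _ _.
have -> : a - b - c - q = a - c - q - b by ring.
apply => s s01; have /= sdel := le_lt_trans (sv _ s01) v1.
apply: (le_trans (@bil1_le _ _ (e / d.+1%:R * `|v|) _)) => [k|].
  rewrite [X in `|X|](_ : _ = partial k f (x + s *: v) - partial k f x
    - (s *: v *m hessm f x) 0 k); last by rewrite -scalemxAl !mxE.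
  apply: (le_trans (del1P _ sdel k)).
  by apply: ler_wpM2l; [rewrite divr_ge0 ?ltW|exact: sv].
rewrite mulrA -mulrA -expr2 ler_wpM2r ?exprn_ge0// mulrCA ler_piMr ?(ltW e0)//.
by rewrite ler_pdivrMr// mul1r ler_nat.
Qed.

(** Normalized by [h ^+ 2] it tends to a mixed second partial derivative; as it is
unchanged when [a] and [b] are exchanged, the Hessian is symmetric, and as it is
a linear combination of values of [f], so is, in the limit, the Hessian. *)
Definition second_difference f x (a b : 'I_d) (h : R) : R :=
  f (x + h *: delta_mx 0 a + h *: delta_mx 0 b) - f (x + h *: delta_mx 0 a)
  - f (x + h *: delta_mx 0 b) + f x.

(** The second difference is the increment, along coordinate [b], of
f(x + h e_a + s h e_b) - f(x + s h e_b); the derivative in [s] is expanded by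
[taylor1_grad]. *)
Lemma second_differenceP U f x a b (e : R) : open U -> C2_on U f -> U x ->
  0 < e -> exists2 del : R, 0 < del & forall h, `|h| < del ->
    `|second_difference f x a b h - h ^+ 2 * hessm f x a b| <= e * h ^+ 2.
Proof.
move=> oU fC2 Ux e0; have e3 : 0 < e / 4 by rewrite divr_gt0.
have [del1 del10 del1P] := taylor1_grad oU fC2 Ux e3.
have [del2 del20 del2P] := open_nbhs0 oU Ux.
exists (Num.min del1 del2 / 2); first by rewrite divr_gt0// lt_min del10.
move=> h; rewrite ltr_pdivlMr// lt_min => /andP[h1 h2].
pose ea : 'rV[R]_d := h *: delta_mx 0 a; pose eb : 'rV[R]_d := h *: delta_mx 0 b.
have ne (k : 'I_d) (s : R) : 0 <= s <= 1 ->
    `|s *: (h *: delta_mx 0 k : 'rV[R]_d)| <= `|h|.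
  move=> /andP[s0 s1]; rewrite !normrZ ger0_norm//.
  rewrite (le_trans (ler_piMl _ s1))// ?mulr_ge0// ler_piMr//.
  exact: norm_delta_le.
have ne1 (s : R) : 0 <= s <= 1 -> `|ea + s *: eb| <= 2 * `|h|.
  move=> s01; rewrite (le_trans (ler_normD _ _))// mulr_natl mulr2n lerD//; last exact: ne.
  by have := ne a 1; rewrite scale1r; apply; rewrite ler01 lexx.
have ne2 (s : R) : 0 <= s <= 1 -> `|s *: eb| <= 2 * `|h|.
  by move=> s01; rewrite (le_trans (ne _ _ s01))// ler_peMl// ler1n.
pose psi (s : R) : R^o := f (x + ea + s *: eb) - f (x + s *: eb)
  - s * (h ^+ 2 * hessm f x a b).
pose dps (s : R) : R := h * (partial b f (x + ea + s *: eb)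
  - partial b f (x + s *: eb) - h * hessm f x a b).
have gradb (z : 'rV[R]_d) : bil 1%:M eb (gradv f z) = h * partial b f z.
  rewrite bilZl bil1E (bigD1 b)//= big1 => [|k /negPf kb]; last first.
    by rewrite !mxE kb mul0r.
  by rewrite !mxE !eqxx mul1r addr0.
have dpsi (s : R) : 0 <= s <= 1 -> is_derive s (1 : R) psi (dps s).
  move=> s01.
  have Ua : U (x + ea + s *: eb).
    by rewrite -addrA; apply: del2P; rewrite (le_lt_trans (ne1 _ s01))// mulrC.
  have Ub : U (x + s *: eb).
    by apply: del2P; rewrite (le_lt_trans (ne2 _ s01))// mulrC.
  have da := C1_line oU fC2.1 Ua; have db := C1_line oU fC2.1 Ub.
  have dm : is_derive s (1 : R)
      (fun r : R => r * (h ^+ 2 * hessm f x a b) : R^o) (h ^+ 2 * hessm f x a b).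
    by apply: is_derive_eq; rewrite scaler0 add0r [LHS]mulr1.
  apply: (is_derive_eq (is_deriveB (is_deriveB da db) dm)).
  rewrite !gradb /dps; ring.
have := mean_value_le dpsi (C := e * h ^+ 2).
have -> : psi 1 - psi 0 = second_difference f x a b h - h ^+ 2 * hessm f x a b.
  rewrite /psi /second_difference !scale1r !scale0r !addr0 mul1r mul0r subr0.
  by rewrite -/ea -/eb; ring.
apply => s s01; rewrite /dps normrM.
have b1 := del1P (ea + s *: eb) _ b; have b2 := del1P (s *: eb) _ b.
have rowE1 : ((ea + s *: eb) *m hessm f x) 0 b =
    h * hessm f x a b + (s *: eb *m hessm f x) 0 b.
  rewrite mulmxDl mxE; congr (_ + _).
  by rewrite /ea -scalemxAl -rowE !mxE.
rewrite {}rowE1 addrA in b1.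
have h2del : 2 * `|h| < del1 by rewrite mulrC.
have {}b1 := le_trans (b1 (le_lt_trans (ne1 _ s01) h2del))
  (ler_wpM2l (ltW e3) (ne1 _ s01)).
have {}b2 := le_trans (b2 (le_lt_trans (ne2 _ s01) h2del))
  (ler_wpM2l (ltW e3) (ne2 _ s01)).
rewrite [leRHS](_ : _ = `|h| * (e * `|h|)); last first.
  by rewrite [RHS]mulrCA -expr2 real_normK ?num_real.
rewrite ler_wpM2l//.
move: b1 b2; rewrite !ler_norml => /andP[b1 b1'] /andP[b2 b2'].
apply/andP; split; lra.
Qed.

Lemma second_difference_cvg U f x a b (e : R^nat) : open U -> C2_on U f -> U x ->
  (forall n, e n != 0) -> e n @[n --> \oo] --> 0 ->
  (e n) ^- 2 * second_difference f x a b (e n) @[n --> \oo] --> hessm f x a b.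
Proof.
move=> oU fC2 Ux en0 e0; apply/cvgrPdistC_le => eps eps0.
have [del del0 delP] := second_differenceP a b oU fC2 Ux eps0.
near=> n; have : `|e n| < del by near: n; exact: (cvgr0_norm_lt _ e0).
have en2 : 0 < e n ^+ 2 by rewrite lt_def sqrf_eq0 en0 sqr_ge0.
move=> /delP; rewrite -ler_pdivrMr//.
apply: le_trans; rewrite [in leRHS]mulrC.
rewrite -[(e n ^+ 2)^-1 in leRHS]ger0_norm ?invr_ge0 ?sqr_ge0// -normrM mulrBr.
by rewrite mulKf// expf_neq0.
Unshelve. all: by end_near. Qed.

Lemma hessm_sym U f x : open U -> C2_on U f -> U x ->
  (hessm f x)^T = hessm f x.
Proof.
move=> oU fC2 Ux; apply/matrixP => a b; rewrite [LHS]mxE.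
pose e (n : nat) : R := n.+1%:R^-1.
have en0 n : e n != 0 by rewrite invr_eq0.
have e0 : e n @[n --> \oo] --> 0 by exact: cvg_harmonic.
have cab := second_difference_cvg (a := b) (b := a) oU fC2 Ux en0 e0.
have cba := second_difference_cvg (a := a) (b := b) oU fC2 Ux en0 e0.
apply: cvg_unique cab _ => //=; apply: cvg_trans cba; apply: near_eq_cvg.
near=> n; rewrite /second_difference; congr (_ * (_ + _)).
by rewrite [x + _ + _]addrAC -!addrA; congr (_ + _); exact: addrC.
Unshelve. all: by end_near. Qed.

Lemma partial_cvg U f x k (e : R^nat) : open U -> C1_on U f -> U x ->
  (forall n, e n != 0) -> e n @[n --> \oo] --> 0 ->
  (e n)^-1 * (f (x + e n *: delta_mx 0 k) - f x) @[n --> \oo] --> partial k f x.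
Proof.
move=> oU fC1 Ux en0 e0; apply/cvgrPdistC_le => eps eps0.
have [del del0 delP] := coordinate_increment oU fC1 Ux eps0.
near=> n.
have endel : `|x + e n *: delta_mx 0 k - x| < del.
  rewrite addrAC subrr add0r normrZ.
  rewrite (@le_lt_trans _ _ `|e n|) ?ler_piMr ?norm_delta_le//.
  by near: n; exact: (cvgr0_norm_lt _ e0).
have /delP/(_ endel) : `|x - x| < del by rewrite subrr normr0.
rewrite [leRHS]mulrC -ler_pdivrMl ?normr_gt0//; apply: le_trans.
by rewrite -normfV -normrM [in leRHS]mulrBr mulKf.
Unshelve. all: by end_near. Qed.

End taylor.

(** * Integrals, normal laws and square-integrable variables *)

Section integral_negligible.
Context {dT : measure_display} {T : measurableType dT} {R : realType}.
Variable mu : {measure set T -> \bar R}.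
Local Open Scope ereal_scope.
Import HBNNSimple.

Let le_integral_off_negligible (f g : T -> \bar R) (N : set T) :
  measurable N -> mu N = 0 -> (forall w, 0 <= f w) -> (forall w, 0 <= g w) ->
  (forall w, ~ N w -> f w = g w) -> \int[mu]_w f w <= \int[mu]_w g w.
Proof.
move=> mN N0 f0 g0 fg; rewrite !ge0_integralTE//.
apply: ge_ereal_sup => _ [h /= hf <-].
pose h' := mul_nnsfun h (indic_nnsfun R (measurableC mN)).
have -> : sintegral mu h = sintegral mu h'.
  rewrite -!integralT_nnsfun; apply: ge0_ae_eq_integral => //.
  - exact/measurable_EFinP.
  - exact/measurable_EFinP.
  - by move=> w _; rewrite lee_fin.
  - by move=> w _; rewrite lee_fin.
  exists N; split => // w /=; apply: contra_notP => Nw _.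
  by rewrite /h'/= /mindic indicE mem_set// mulr1.
apply: ereal_sup_ubound; exists h' => //= w; rewrite /mindic indicE.
have [Nw|Nw] := pselect (N w).
  by rewrite memNset ?mulr0//; apply.
by rewrite mem_set// mulr1 -fg.
Qed.

(** Derivatives of a random field exist only almost surely, so that on a space that
is not complete they may fail to be measurable; their integrals still depend
only on values off a negligible set, because a simple function below the
integrand may be cut off there. *)
Lemma eq_integral_off_negligible (f g : T -> \bar R) (N : set T) :
  measurable N -> mu N = 0 -> (forall w, ~ N w -> f w = g w) ->
  \int[mu]_w f w = \int[mu]_w g w.
Proof.
move=> mN N0 fg; rewrite integralE [RHS]integralE.
congr (_ - _); apply/eqP; rewrite eq_le; apply/andP; split;
  apply: (le_integral_off_negligible mN N0) => // w Nw;
  by rewrite ?funeposE ?funenegE fg.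
Qed.

End integral_negligible.

Section normal_moment.
Context {R : realType}.
Local Notation mu := (@lebesgue_measure R).

(** Doubling the standard deviation slows down the exponential decay enough to
absorb the quadratic factor. *)
Lemma sqr_normal_pdf_le (m s y : R) : s != 0 ->
  (y - m) ^+ 2 * normal_pdf m s y <= 6 * s ^+ 2 * normal_pdf m (2 * s) y.
Proof.
move=> s0; have s2 : 0 < s ^+ 2 by rewrite lt_def sqrf_eq0 s0 sqr_ge0.
rewrite !normal_pdfE ?mulf_neq0//.
have -> : normal_peak (2 * s) = normal_peak s / 2 :> R.
  rewrite /normal_peak.
  have -> : (2 * s) ^+ 2 * pi *+ 2 = (s ^+ 2 * pi *+ 2) * 2 ^+ 2 :> R.
    by rewrite ![_ * pi *+ 2]mulr2n; ring.
  rewrite sqrtrM; last by rewrite mulrn_wge0// mulr_ge0 ?pi_ge0// ltW.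
  by rewrite sqrtr_sqr ger0_norm// invfM.
pose u := (y - m) ^+ 2 / (s ^+ 2 *+ 2).
have u0 : 0 <= u by rewrite divr_ge0 ?sqr_ge0// mulrn_wge0// ltW.
have -> : normal_fun m s y = expR (- u) by rewrite /normal_fun mulNr.
have -> : normal_fun m (2 * s) y = expR (- (u / 4)).
  congr expR; rewrite mulNr /u; congr (- _).
  have -> : (2 * s) ^+ 2 *+ 2 = (s ^+ 2 *+ 2) * 4 by rewrite !mulr2n; ring.
  by rewrite invfM mulrA.
have -> : (y - m) ^+ 2 = 2 * s ^+ 2 * u.
  rewrite /u -[s ^+ 2 *+ 2]mulr_natl mulrC divfK//.
  by rewrite mulf_neq0// sqrf_eq0.
set p := normal_peak s; have p0 : 0 <= p by exact: normal_peak_ge0.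
(* the factor [u] is absorbed by exp (3 u / 4) >= 1 + 3 u / 4 *)
have ue : u * expR (- u) <= 4 / 3 * expR (- (u / 4)).
  have -> : - (u / 4) = 3 / 4 * u + - u by lra.
  rewrite expRD mulrA ler_wpM2r ?expR_ge0//.
  have := expR_ge1Dx (3 / 4 * u); lra.
have e0 : 0 <= expR (- (u / 4)) by exact: expR_ge0.
rewrite [leLHS](_ : _ = 2 * (s ^+ 2 * p) * (u * expR (- u))); last by ring.
rewrite [leRHS](_ : _ = 2 * (s ^+ 2 * p) * (3 / 2 * expR (- (u / 4)))); last first.
  by field.
by apply: ler_wpM2l; [exact: mulr_ge0 (mulr_ge0 (ltW s2) p0)|lra].
Qed.

(** The density of [normal_prob] agrees almost everywhere with its
Radon-Nikodym derivative, both having the same integral on every measurable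
set. *)
Lemma ge0_integral_normal_prob (m s : R) (f : R -> \bar R) :
  measurable_fun [set: R] f -> (forall y, 0 <= f y)%E ->
  (\int[normal_prob m s]_y f y = \int[mu]_y (f y * (normal_pdf m s y)%:E))%E.
Proof.
move=> mf f0; pose dom := normal_prob_dominates m s.
rewrite -(Radon_Nikodym_SigmaFinite.change_of_variables dom)//.
apply: ae_eq_integral => //.
- apply: emeasurable_funM => //.
  exact: measurable_int (Radon_Nikodym_SigmaFinite.f_integrable dom).
- apply: emeasurable_funM => //; apply/measurable_EFinP.
  exact: measurable_normal_pdf.
- apply: ae_eqe_mul2l; apply: integral_ae_eq => //.
  + exact: Radon_Nikodym_SigmaFinite.f_integrable.
  + by apply/measurable_EFinP; exact: measurable_normal_pdf.
  + by move=> A _ mA; rewrite -Radon_Nikodym_SigmaFinite.f_integral.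
Qed.

(** By [sqr_normal_pdf_le] it is dominated, up to a constant, by the total mass of a
normal law of twice the standard deviation. *)
Lemma normal_prob_second_moment (m s : R) : s != 0 ->
  (\int[normal_prob m s]_y ((y - m) ^+ 2)%:E <= (6 * s ^+ 2)%:E)%E.
Proof.
move=> s0; rewrite ge0_integral_normal_prob//; last 2 first.
- apply/measurable_EFinP; apply: measurable_funX; exact: measurable_funB.
- by move=> y; rewrite lee_fin sqr_ge0.
rewrite -[leRHS]mule1 -(integral_normal_pdf m (2 * s)) -ge0_integralZl//.
- apply: ge0_le_integral => //.
  + by move=> y _; rewrite -EFinM lee_fin mulr_ge0 ?sqr_ge0 ?normal_pdf_ge0.
  + apply: emeasurable_funM; apply/measurable_EFinP.
      by apply: measurable_funX; exact: measurable_funB.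
    exact: measurable_normal_pdf.
  + apply: emeasurable_funM => //; apply/measurable_EFinP.
    exact: measurable_normal_pdf.
  + by move=> y _; rewrite -!EFinM lee_fin sqr_normal_pdf_le.
- by apply/measurable_EFinP; exact: measurable_normal_pdf.
- by move=> y _; rewrite lee_fin normal_pdf_ge0.
- by rewrite lee_fin mulr_ge0 ?sqr_ge0.
Qed.

(** The density is bounded by its peak, of order 1 / [s], so that an interval
of length [2 * e] carries a mass at most of order [e / s]. *)
Lemma normal_prob_concentrated (m s e : R) : s != 0 -> 0 < e ->
  ((2^-1)%:E < normal_prob m s [set y | (`|y| < e)%R])%E -> s ^+ 2 <= 4 * e ^+ 2.
Proof.
move=> s0 e0 half; have s2 : 0 < s ^+ 2 by rewrite lt_def sqrf_eq0 s0 sqr_ge0.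
pose B : set R := `]- e, e[%classic.
have ballE : [set y : R | `|y| < e] = B.
  by apply/seteqP; split => y /=; rewrite /B/= in_itv/= ltr_norml.
have : (2^-1 < normal_peak s * (2 * e))%R.
  rewrite -lte_fin (lt_le_trans half)// ballE.
  rewrite (@le_trans _ _ (\int[mu]_(y in B) (normal_peak s)%:E)%E)//.
    apply: ge0_le_integral => //.
    - exact: measurable_itv.
    - by move=> y _; rewrite lee_fin normal_pdf_ge0.
    - apply/measurable_funTS/measurable_EFinP; exact: measurable_normal_pdf.
    - by move=> y _; rewrite lee_fin normal_pdf_ub.
  rewrite integral_cst//=; last exact: measurable_itv.
  rewrite /B lebesgue_measure_itv/= lte_fin.
  by rewrite ifT ?gtrN// -EFinB -EFinM lee_fin opprK; lra.
set A := s ^+ 2 * pi *+ 2.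
have A0 : 0 < A by rewrite mulrn_wgt0// mulr_gt0// pi_gt0.
rewrite /normal_peak -/A mulrC ltr_pdivlMr ?sqrtr_gt0// => h.
have sA : Num.sqrt A < 4 * e by lra.
have : A < (4 * e) ^+ 2.
  rewrite -[ltLHS]sqr_sqrtr ?(ltW A0)// ltr_sqr ?nnegrE ?sqrtr_ge0//.
  by rewrite mulr_ge0// ltW.
have : 2 <= pi :> R by exact: pi_ge2.
rewrite /A mulr2n => pi2 h2.
have : s ^+ 2 * 2 <= s ^+ 2 * pi by rewrite ler_wpM2l// ltW.
move: h2; rewrite exprMn; lra.
Qed.

End normal_moment.

Section square_integrable.
Context {dT : measure_display} {T : measurableType dT} {R : realType}.
Variable P : probability T R.
Implicit Types (Y Z W : T -> R) (a t : R).
Local Notation L2 := (Lfun P 2%:E).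

(** The inner product of L^2, equal to the covariance for centred variables. *)
Definition ip Y Z : R := fine 'E_P[fun w => Y w * Z w].

Lemma L2_measurable Y : Y \in L2 -> measurable_fun [set: T] Y.
Proof. by rewrite inE => /andP[]; rewrite inE. Qed.

Lemma L2P Y : measurable_fun [set: T] Y ->
  (\int[P]_w (Y w ^+ 2)%:E < +oo)%E -> Y \in L2.
Proof.
move=> mY Yfin; rewrite inE; apply/andP; split; rewrite inE//=.
rewrite /finite_norm unlock; apply: poweR_lty.
rewrite (_ : (\int[P]_w _)%E = (\int[P]_w (Y w ^+ 2)%:E)%E)//.
apply: eq_integral => w _ /=; congr EFin.
by rewrite powR_mulrn// real_normK ?num_real.
Qed.

Lemma L2_cst a : cst a \in L2. Proof. exact: (Lfun_cst P a 2). Qed.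

Lemma L2D Y Z : Y \in L2 -> Z \in L2 -> (fun w => Y w + Z w) \in L2.
Proof. exact: (Lfun_addr_closed P (lee1n 2)).2. Qed.

Lemma L2Z a Y : Y \in L2 -> (fun w => a * Y w) \in L2.
Proof.
move=> Y2; rewrite (_ : (fun _ => _) = a *: Y + cst 0).
  exact: (Lfun_submod_closed P (lee1n 2)).2 Y2 (L2_cst 0).
by apply/funext => w; rewrite [RHS]addr0.
Qed.

Lemma L2B Y Z : Y \in L2 -> Z \in L2 -> (fun w => Y w - Z w) \in L2.
Proof.
move=> Y2 /(L2Z (-1)) /(L2D Y2).
by under eq_fun do rewrite mulN1r.
Qed.

Lemma L2_sum (I : Type) (s : seq I) (F : I -> T -> R) :
  (forall i, F i \in L2) -> (fun w => \sum_(i <- s) F i w) \in L2.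
Proof.
move=> F2; elim: s => [|i s IHs].
  by under eq_fun do rewrite big_nil; exact: L2_cst.
by under eq_fun do rewrite big_cons; exact: L2D.
Qed.

Lemma L2_Lfun1 Y : Y \in L2 -> Y \in Lfun P 1.
Proof. by apply: Lfun_subset12; exact: fin_num_measure. Qed.

Lemma ip_fin Y Z : Y \in L2 -> Z \in L2 ->
  (ip Y Z)%:E = 'E_P[(fun w => Y w * Z w)%R]%E.
Proof. by move=> Y2 Z2; rewrite fineK// expectation_fin_num// Lfun2_mul_Lfun1. Qed.

Lemma ipC Y Z : ip Y Z = ip Z Y.
Proof. by congr (fine 'E_P[_]); apply/funext => w; rewrite mulrC. Qed.

Lemma ipDl Y Z W : Y \in L2 -> Z \in L2 -> W \in L2 ->
  ip (fun w => Y w + Z w) W = ip Y W + ip Z W.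
Proof.
move=> Y2 Z2 W2; apply: EFin_inj; rewrite EFinD !ip_fin//; last exact: L2D.
rewrite -expectationD ?Lfun2_mul_Lfun1//.
by congr 'E_P[_]%E; apply/funext => w; rewrite mulrDl.
Qed.

Lemma ipZl a Y Z : Y \in L2 -> Z \in L2 ->
  ip (fun w => a * Y w) Z = a * ip Y Z.
Proof.
move=> Y2 Z2; apply: EFin_inj; rewrite EFinM !ip_fin//; last exact: L2Z.
rewrite -expectationZl ?Lfun2_mul_Lfun1//.
by congr 'E_P[_]%E; apply/funext => w/=; rewrite [RHS]mulrC mulrA.
Qed.

Lemma ip_suml (I : Type) (s : seq I) (F : I -> T -> R) Z :
  (forall i, F i \in L2) -> Z \in L2 ->
  ip (fun w => \sum_(i <- s) F i w) Z = \sum_(i <- s) ip (F i) Z.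
Proof.
move=> F2 Z2; elim: s => [|i s IHs].
  rewrite big_nil /ip (_ : (fun w => _) = cst 0) ?expectation_cst//.
  by apply/funext => w; rewrite big_nil mul0r.
rewrite big_cons -IHs -ipDl//; last exact: L2_sum.
by congr (ip _ _); apply/funext => w; rewrite big_cons.
Qed.

Lemma ipBl Y Z W : Y \in L2 -> Z \in L2 -> W \in L2 ->
  ip (fun w => Y w - Z w) W = ip Y W - ip Z W.
Proof.
move=> Y2 Z2 W2; rewrite -mulN1r -ipZl// -ipDl//; last exact: L2Z.
by congr (ip _ _); apply/funext => w; rewrite mulN1r.
Qed.

Lemma ip_ge0 Y : 0 <= ip Y Y.
Proof. by apply/fine_ge0/expectation_ge0 => w; rewrite -expr2 sqr_ge0. Qed.

Lemma ip_sqr Y : Y \in L2 -> (ip Y Y)%:E = (\int[P]_w (Y w ^+ 2)%:E)%E.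
Proof. by move=> Y2; rewrite ip_fin// unlock. Qed.

Lemma cauchy_schwarz Y Z : Y \in L2 -> Z \in L2 ->
  ip Y Z ^+ 2 <= ip Y Y * ip Z Z.
Proof.
move=> Y2 Z2.
have H t : 0 <= ip Y Y - 2 * t * ip Y Z + t ^+ 2 * ip Z Z.
  have := ip_ge0 (fun w => Y w - t * Z w).
  have tZ2 := L2Z t Z2; have B2 := L2B Y2 tZ2.
  rewrite ipBl// ipZl// (ipC Y) (ipC Z) !ipBl// !ipZl// (ipC Z Y); lra.
have [Z0|Z0] := eqVneq (ip Z Z) 0.
  rewrite Z0 mulr0 leNgt; apply/negP => b2.
  have bneq0 : ip Y Z != 0 by rewrite -sqrf_eq0 gt_eqF.
  have := H ((ip Y Y + 1) / (2 * ip Y Z)); rewrite Z0 mulr0 addr0.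
  rewrite (_ : 2 * _ * _ = ip Y Y + 1); first lra.
  by field.
have Zp : 0 < ip Z Z by rewrite lt_def Z0 ip_ge0.
have := H (ip Y Z / ip Z Z).
rewrite (_ : _ + _ = (ip Y Y * ip Z Z - ip Y Z ^+ 2) / ip Z Z); last by field.
by rewrite pmulr_lge0 ?invr_gt0// subr_ge0.
Qed.

End square_integrable.

(** * Variance control *)

Section variance_control.
Context {dT : measure_display} {T : measurableType dT} {R : realType}.
Variable P : probability T R.
Implicit Types (Y Z W : T -> R) (e : R).
Local Notation L2 := (Lfun P 2%:E).

(** The second moment is controlled by concentration near zero: centred
Gaussian variables have this property with a universal constant, and unlike
being Gaussian it passes easily to pointwise limits. The constant is 24 = 6 * 4,
from [normal_prob_second_moment] and [normal_prob_concentrated]; any other level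
strictly between 0 and 1 would do in place of 1/2, with another constant. *)
Definition var_controlled Y := forall e, 0 < e ->
  ((2^-1)%:E < P [set w | (`|Y w| < e)%R])%E ->
  (\int[P]_w (Y w ^+ 2)%:E <= (24 * e ^+ 2)%:E)%E.

Lemma measurable_abs_lt Y e : measurable_fun [set: T] Y ->
  measurable [set w | `|Y w| < e].
Proof.
move=> mY; have mn : measurable_fun [set: T] (fun w => `|Y w|).
  exact: measurableT_comp.
have := mn measurableT `]-oo, e[%classic (measurable_itv _).
by rewrite setTI; congr (measurable _); apply/seteqP; split => w /=; rewrite in_itv.
Qed.

(** A centred Gaussian variable that stays in [(-e, e)] with probability more
than 1/2 has standard deviation at most of order [e], because its density is
bounded by the inverse of its standard deviation. *)
Lemma gaussian_var_controlled Y : Y \in L2 -> 'E_P[Y]%E = 0%E ->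
  is_gaussian P Y -> var_controlled Y.
Proof.
move=> Y2 EY [m [s]] gY e e0; have mY := L2_measurable Y2.
have mball : measurable [set y : R | `|y| < e].
  rewrite (_ : [set y : R | _] = `]- e, e[%classic); first exact: measurable_itv.
  by apply/seteqP; split => y /=; rewrite in_itv/= ltr_norml.
case: gY => [[s0 gY]|gY] half.
  have {half} s2 : s ^+ 2 <= 4 * e ^+ 2.
    by apply: (@normal_prob_concentrated _ m) => //; rewrite -gY.
  have Ym : (\int[P]_w ((Y w - m) ^+ 2)%:E <= (24 * e ^+ 2)%:E)%E.
    pose GR := measurableTypeR R.
    have mYin : (Y : T -> GR) \in mfun by rewrite inE.
    pose YY : {RV P >-> GR} := mfun_Sub mYin.
    have mf : measurable_fun [set: GR] (fun y : GR => ((y - m) ^+ 2)%:E).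
      by apply/measurable_EFinP; apply: measurable_funX; exact: measurable_funB.
    have := @ge0_integral_distribution _ _ _ _ _ P YY _ mf.
    rewrite /comp/= => <-; last by move=> y; rewrite lee_fin sqr_ge0.
    rewrite (@eq_measure_integral _ _ _ setT (normal_prob m s)); last first.
      by move=> A mA _; exact: gY.
    apply: (le_trans (normal_prob_second_moment m s0)).
    by rewrite lee_fin; lra.
  have Ym2 : (fun w => Y w - m) \in L2 by exact: (L2B Y2 (L2_cst P m)).
  apply: le_trans Ym; rewrite -ip_sqr// -ip_sqr// lee_fin.
  have ipY1 : ip P Y (cst m) = 0.
    rewrite ipC (_ : cst m = (fun w => m * cst 1 w)); last first.
      by apply/funext => w; rewrite mulr1.
    rewrite ipZl ?L2_cst// /ip (_ : (fun w => _) = Y) ?EY ?mulr0//.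
    by apply/funext => w; rewrite mul1r.
  rewrite (ipBl Y2 (L2_cst P m) Ym2) ipC [ip P (cst m) _]ipC.
  rewrite !(ipBl Y2 (L2_cst P m))// ?L2_cst// ipY1 [ip P (cst m) Y]ipC ipY1.
  by have := ip_ge0 P (cst m); lra.
have {half} me : `|m| < e.
  move: half; rewrite -[X in P X]/(Y @^-1` [set y : R | `|y| < e]) gY//.
  rewrite diracE; case: (boolP (m \in _)) => [|_]; first by rewrite inE.
  by rewrite lte_fin /= invr_lt0 ltNge ler0n.
rewrite (@eq_integral_off_negligible _ _ _ P _ (cst (m ^+ 2)%:E)
   (Y @^-1` (~` [set m]))).
- rewrite integral_cst//= probability_setT mule1 lee_fin.
  have : `|m| ^+ 2 <= e ^+ 2 by rewrite lerXn2r// ?nnegrE ?ltW.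
  by rewrite real_normK ?num_real//; have := sqr_ge0 e; lra.
- have := mY measurableT (~` [set m]); rewrite setTI; apply.
  by apply: measurableC; exact: measurable_set1.
- transitivity (\d_m (~` [set m]) : \bar R).
    by apply: gY; apply: measurableC; exact: measurable_set1.
  by rewrite diracE memNset//=; apply.
- by move=> w /= /contrapT ->.
Qed.

(** If [|Y| < e] then [|Yn m| < e] for all large [m]; the events that this holds
from [n] on increase with [n], so their probabilities eventually exceed 1/2. *)
Lemma near_concentrated (Yn : (T -> R)^nat) Y e :
  (forall n, measurable_fun [set: T] (Yn n)) ->
  (forall w, Yn n w @[n --> \oo] --> Y w) -> measurable_fun [set: T] Y ->
  ((2^-1)%:E < P [set w | (`|Y w| < e)%R])%E ->
  \forall n \near \oo, ((2^-1)%:E < P [set w | (`|Yn n w| < e)%R])%E.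
Proof.
move=> mYn cYn mY half.
pose B n := \bigcap_(m in [set m | (n <= m)%N]) [set w | `|Yn m w| < e].
have mB n : measurable (B n).
  by apply: bigcap_measurable => [|m _]; [exists n => /=|exact: measurable_abs_lt].
have BU : [set w | `|Y w| < e] `<=` \bigcup_n B n.
  move=> w /= Yw.
  have : \forall n \near \oo, `|Yn n w| < e.
    have cn : `|Yn n w| @[n --> \oo] --> `|Y w| by exact: cvg_norm.
    exact: (cvgr_lt _ cn).
  by move=> [n _ nP]; exists n => // m /= nm; exact: nP.
have PB : ((2^-1)%:E < P (\bigcup_n B n))%E.
  apply: lt_le_trans half _; apply: le_measure => //; rewrite inE.
    exact: measurable_abs_lt.
  exact: bigcup_measurable.
have cvB : P (B n) @[n --> \oo] --> P (\bigcup_n B n).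
  apply: nondecreasing_cvg_mu => //; first exact: bigcup_measurable.
  move=> n m nm; apply/subsetPset => w Bn k /= mk; apply: Bn => /=.
  exact: leq_trans mk.
have [n Bn] : exists n, ((2^-1)%:E < P (B n))%E.
  apply: contrapT => /forallNP no; move: PB; rewrite ltNge => /negP; apply.
  rewrite -(cvg_lim _ cvB)//; apply: lime_le; first exact: cvgP cvB.
  by apply: nearW => n; rewrite leNgt; apply/negP/no.
exists n => // m /= nm; apply: (lt_le_trans Bn).
apply: le_measure; rewrite ?inE//; first exact: measurable_abs_lt.
by move=> w; apply.
Qed.

Lemma limn_einf_le (u : (\bar R)^nat) (C : \bar R) :
  (\forall n \near \oo, (u n <= C)%E) -> (limn_einf u <= C)%E.
Proof.
move=> [n0 _ n0P]; rewrite limn_einf_lim; apply: lime_le.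
  exact: is_cvg_einfs.
apply: nearW => n; rewrite /einfs/=.
rewrite (@le_trans _ _ (u (maxn n n0)))//.
  by apply: ereal_inf_lbound; exists (maxn n n0) => //=; exact: leq_maxl.
by apply: n0P => /=; exact: leq_maxr.
Qed.

(** Concentration of the limit is inherited by the sequence from some rank on,
and Fatou's lemma brings the bound on second moments back to the limit. *)
Lemma var_controlled_lim (Yn : (T -> R)^nat) Y :
  (forall n, measurable_fun [set: T] (Yn n)) ->
  (forall n, var_controlled (Yn n)) ->
  (forall w, Yn n w @[n --> \oo] --> Y w) -> var_controlled Y.
Proof.
move=> mYn vYn cYn e e0 half.
have mY : measurable_fun [set: T] Y by exact: (measurable_fun_cvg mYn).
have nh := near_concentrated mYn cYn mY half.
have -> : (\int[P]_w (Y w ^+ 2)%:E =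
    \int[P]_w limn_einf (fun n => (Yn n w ^+ 2)%:E))%E.
  apply: eq_integral => w _.
  have cw : (Yn n w ^+ 2)%:E @[n --> \oo] --> (Y w ^+ 2)%:E.
    apply: cvg_EFin; first exact: nearW.
    by rewrite /comp/= expr2; under eq_fun do rewrite expr2; exact: cvgM.
  by have [-> _] := cvg_limn_einf_sup cw.
apply: le_trans (fatou P measurableT _ _) _.
- by move=> n; apply/measurable_EFinP; exact: measurable_funX.
- by move=> n w _; rewrite lee_fin sqr_ge0.
apply: limn_einf_le; near=> n; apply: vYn => //; near: n; exact: nh.
Unshelve. all: by end_near. Qed.

(** A small enough multiple of the variable lies in (-1, 1) with probability more
than 1/2. *)
Lemma var_controlled_L2 Y : measurable_fun [set: T] Y -> var_controlled Y ->
  Y \in L2.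
Proof.
move=> mY vY; pose Yn n w := n.+1%:R^-1 * Y w.
have cYn w : Yn n w @[n --> \oo] --> 0.
  rewrite -[X in _ --> X](mul0r (Y w)); apply: cvgM; last exact: cvg_cst.
  exact: cvg_harmonic.
have mYn n : measurable_fun [set: T] (Yn n) by exact: measurable_funM.
have half : ((2^-1)%:E < P [set w | (`|(cst 0 : T -> R) w| < 1)%R])%E.
  rewrite (_ : [set w | _] = setT) ?probability_setT ?lte_fin; last first.
    by apply/seteqP; split => w //= _; rewrite normr0.
  lra.
have [n _ /(_ n (leqnn n)) hn] := near_concentrated mYn cYn (measurable_cst _) half.
apply: L2P => //; apply: le_lt_trans (vY n.+1%:R _ _) (ltry _) => //.
apply: lt_le_trans hn _; apply: le_measure; rewrite ?inE//; try exact: measurable_abs_lt.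
move=> w /=; rewrite /Yn normrM normfV normr_nat.
by rewrite ltr_pdivrMl// mulr1.
Qed.

(** Variables that tend to zero pointwise are eventually concentrated near zero,
so that variance control turns pointwise convergence into convergence in mean
square. *)
Lemma var_controlled_cvg0 (Yn : (T -> R)^nat) e :
  (forall n, measurable_fun [set: T] (Yn n)) ->
  (forall n, var_controlled (Yn n)) ->
  (forall w, Yn n w @[n --> \oo] --> 0) -> 0 < e ->
  \forall n \near \oo, ip P (Yn n) (Yn n) <= e.
Proof.
move=> mYn vYn cYn e0; pose eta := Num.sqrt (e / 24).
have eta0 : 0 < eta by rewrite sqrtr_gt0 divr_gt0.
have half : ((2^-1)%:E < P [set w | (`|(cst 0 : T -> R) w| < eta)%R])%E.
  rewrite (_ : [set w | _] = setT) ?probability_setT ?lte_fin; last first.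
    by apply/seteqP; split => w //= _; rewrite normr0.
  lra.
have nh := near_concentrated mYn cYn (measurable_cst _) half.
near=> n; rewrite -lee_fin ip_sqr; last exact: var_controlled_L2.
apply: le_trans (vYn n _ eta0 _) _; first by near: n.
by rewrite lee_fin sqr_sqrtr ?divr_ge0 ?(ltW e0)// mulrC divfK.
Unshelve. all: by end_near. Qed.

End variance_control.

(** * Second-order remainders *)

Section little_o2.
Context {R : realType} {V : normedModType R}.
Implicit Types (F G : V -> R).

Definition is_o2 F := forall e : R, 0 < e ->
  \forall v \near (0 : V), `|F v| <= e * `|v| ^+ 2.

Lemma is_o2D F G : is_o2 F -> is_o2 G -> is_o2 (fun v => F v + G v).
Proof.
move=> oF oG e e0; have e2 : 0 < e / 2 by rewrite divr_gt0.
near=> v; rewrite (le_trans (ler_normD _ _))// [in leRHS](splitr e) mulrDl.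
by rewrite lerD//; near: v; [exact: oF|exact: oG].
Unshelve. all: by end_near. Qed.

Lemma is_o2Z (k : R) F : is_o2 F -> is_o2 (fun v => k * F v).
Proof.
move=> oF e e0; have k0 : 0 < `|k| + 1 by rewrite ltr_wpDl.
near=> v; rewrite normrM.
have Fv : `|F v| <= e / (`|k| + 1) * `|v| ^+ 2 by near: v; apply: oF; rewrite divr_gt0.
apply: (@le_trans _ _ ((`|k| + 1) * `|F v|)); first by rewrite ler_wpM2r// lerDl.
by rewrite -ler_pdivlMl// mulrA [_^-1 * e]mulrC.
Unshelve. all: by end_near. Qed.

Lemma is_o2_sum (I : Type) (s : seq I) (F : I -> V -> R) :
  (forall i, is_o2 (F i)) -> is_o2 (fun v => \sum_(i <- s) F i v).
Proof.
move=> oF; elim: s => [|i s IHs].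
  move=> e e0; near=> v; rewrite big_nil normr0 mulr_ge0 ?exprn_ge0//.
  exact: ltW.
by under eq_fun do rewrite big_cons; exact: is_o2D.
Unshelve. all: by end_near. Qed.

End little_o2.

Lemma is_o2_line (R : realType) (V : normedModType R) (F : V -> R) (v : V) :
  is_o2 F -> is_o2 (fun h : R^o => F (h *: v)).
Proof.
move=> oF e e0; have v0 : 0 < `|v| + 1 by rewrite ltr_wpDl.
have eV : 0 < e / (`|v| + 1) ^+ 2 by rewrite divr_gt0// exprn_gt0.
have [del /= del0 delP] := (nbhs_norm0P).1 (oF _ eV).
apply/nbhs_norm0P; exists (del / (`|v| + 1)); first exact: divr_gt0.
move=> h /=; rewrite ltr_pdivlMr// => hdel.
have hv : `|h *: v| <= `|h| * (`|v| + 1) by rewrite normrZ ler_wpM2l// lerDl.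
apply: (le_trans (delP _ (le_lt_trans hv hdel))).
rewrite mulrAC ler_pdivrMr ?exprn_gt0// -mulrA.
apply: ler_wpM2l; first exact: ltW.
by rewrite -exprMn lerXn2r ?nnegrE// mulr_ge0// ltW.
Qed.

Section little_o2_real.
Context {R : realType}.
Implicit Types (F : R^o -> R).

Lemma is_o2_cube : is_o2 (fun h : R^o => h ^+ 3).
Proof.
move=> e e0; apply/nbhs_norm0P; exists e => // h /= he.
by rewrite normrX exprS ler_wpM2r ?exprn_ge0// ltW.
Qed.

Lemma is_o2_mulh F : is_o2 F -> is_o2 (fun h : R^o => h * F h).
Proof.
move=> oF e e0; near=> h; rewrite normrM.
apply: (@le_trans _ _ (1 * `|F h|)).
  rewrite ler_wpM2r//; near: h; apply/nbhs_norm0P; exists 1 => //=.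
by rewrite mul1r; near: h; exact: oF.
Unshelve. all: by end_near. Qed.

End little_o2_real.

Section little_o2_row.
Context {R : realType} {d : nat}.
Implicit Types (F G : 'rV[R]_d -> R) (v : 'rV[R]_d).

Lemma mulmx_norm_le (B : 'M[R]_d) :
  exists2 C : R, 0 < C & forall v, `|v *m B| <= C * `|v|.
Proof.
exists (1 + \sum_k \sum_j `|B k j|) => [|v].
  by rewrite ltr_wpDr// sumr_ge0// => k _; rewrite sumr_ge0.
change (mx_norm (v *m B) <= (1 + \sum_k \sum_j `|B k j|) * `|v|); rewrite mx_normrE.
apply/bigmax_leP; split.
  by rewrite mulr_ge0// addr_ge0// sumr_ge0// => k _; rewrite sumr_ge0.
move=> [i j] _ /=; rewrite mxE (le_trans (ler_norm_sum _ _ _))//.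
rewrite mulrDl mul1r mulr_suml.
rewrite (@le_trans _ _ (\sum_k (\sum_j `|B k j|) * `|v|)) ?lerDr//.
apply: ler_sum => k _; rewrite (ord1 i) normrM mulrC ler_pM ?coord_le_norm//.
by rewrite (bigD1 j)//= lerDl sumr_ge0.
Qed.

Lemma is_o2_mulmx F (B : 'M[R]_d) : is_o2 F -> is_o2 (fun v => F (v *m B)).
Proof.
move=> oF e e0; have [C C0 CB] := mulmx_norm_le B.
have eC : 0 < e / C ^+ 2 by rewrite divr_gt0// exprn_gt0.
have /nbhs_norm0P[del del0 delP] := oF _ eC.
apply/nbhs_norm0P; exists (del / C); first exact: divr_gt0.
move=> v /=; rewrite ltr_pdivlMr// mulrC => vdel.
apply: (le_trans (delP _ (le_lt_trans (CB v) vdel))).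
rewrite mulrAC ler_pdivrMr ?exprn_gt0// -mulrA.
apply: ler_wpM2l; first exact: ltW.
by rewrite mulrC -exprMn lerXn2r ?nnegrE// mulr_ge0// ltW.
Qed.

(** Identities between expectations are obtained below by expanding a known
function of the displacement along a line and reading off the coefficients. *)
Lemma o2_line_eq0 (a b : R) :
  is_o2 (fun h : R^o => h * a + h ^+ 2 * b) -> a = 0 /\ b = 0.
Proof.
move=> oab.
have H e : 0 < e -> \forall h \near (0 : R^o), `|h * a + h ^+ 2 * b| <= e * h ^+ 2.
  by move=> /oab; apply: filterS => h; rewrite real_normK ?num_real.
have small_eq0 (c : R) : (forall e, 0 < e -> `|c| <= e) -> c = 0.
  move=> cs; apply/eqP; rewrite -normr_eq0 eq_le normr_ge0 andbT.
  by apply/ler_addgt0Pl => e e0; rewrite addr0; exact: cs.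
have a0 : a = 0.
  apply: small_eq0 => e e0.
  have b1 : 0 < `|b| + 1 by rewrite ltr_wpDl.
  have [del /= del0 delP] := (nbhs_norm0P).1 (H 1 ltr01).
  pose h := Num.min (del / 2) (e / (`|b| + 1)).
  have h0 : 0 < h by rewrite lt_min !divr_gt0.
  have hdel : `|h| < del.
    rewrite ger0_norm ?ltW// (@le_lt_trans _ _ (del / 2))//.
      by rewrite ge_min lexx.
    by rewrite ltr_pdivrMr// ltr_pMr// ltr1n.
  have he : h * (`|b| + 1) <= e by rewrite -ler_pdivlMr// ge_min lexx orbT.
  have : h * `|a| <= h * (h * (`|b| + 1)).
    rewrite -{1}(ger0_norm (ltW h0)) -normrM.
    have -> : h * a = (h * a + h ^+ 2 * b) - h ^+ 2 * b by ring.
    rewrite (le_trans (ler_normB _ _))// normrM [`|h ^+ 2|]ger0_norm ?sqr_ge0//.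
    by have := delP _ hdel; lra.
  by rewrite ler_pM2l// => /le_trans; apply.
split => //; apply: small_eq0 => e e0.
have [del /= del0 delP] := (nbhs_norm0P).1 (H e e0).
have hdel : `|del / 2| < del.
  by rewrite ger0_norm ?divr_ge0 ?ltW// ltr_pdivrMr// ltr_pMr// ltr1n.
have := delP _ hdel; rewrite a0 mulr0 add0r normrM [leLHS]mulrC.
by rewrite [`|_ ^+ 2|]ger0_norm ?sqr_ge0// ler_pM2r// exprn_gt0// divr_gt0.
Qed.

End little_o2_row.

(** * Mean-square Taylor expansion of a random function *)

Section random_taylor.
Context {dT : measure_display} {T : measurableType dT} {R : realType} {d : nat}.
Variable P : probability T R.
Variables (U : set 'rV[R]_d) (x0 : 'rV[R]_d) (f : T -> 'rV[R]_d -> R^o).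
Implicit Types (Y Z : T -> R) (u v x : 'rV[R]_d) (s : seq (R * 'rV[R]_d)).
Local Notation L2 := (Lfun P 2%:E).
Local Notation ip := (ip P).

Definition lincomb s (w : T) : R := \sum_(z <- s) z.1 * f w z.2.

Hypotheses (oU : open U) (Ux0 : U x0) (fC2 : forall w, C2_on U (f w)).
Hypothesis mf : forall x, measurable_fun [set: T] (fun w => f w x).
Hypothesis vf : forall s, var_controlled P (lincomb s).
Hypothesis meanf : forall x, ('E_P[fun w => f w x] = 0)%E.
Hypothesis varf : forall x, ip (fun w => f w x) (fun w => f w x) = 1.

(** The class of variables obtained from the field by linear combinations and
pathwise limits of sequences: it contains the derivatives and Taylor remainders,
and its members are square-integrable and variance-controlled. The limits are
in the everywhere sense, which keeps them measurable. *)
Definition lincomb_limit Y :=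
  exists sn : nat -> seq (R * 'rV[R]_d), forall w, lincomb (sn n) w @[n --> \oo] --> Y w.

Lemma lincomb_measurable s : measurable_fun [set: T] (lincomb s).
Proof. by apply: measurable_sum => z; exact: measurable_funM. Qed.

Lemma limit_measurable Y : lincomb_limit Y -> measurable_fun [set: T] Y.
Proof.
move=> [sn snY]; apply: (measurable_fun_cvg (h := fun n => lincomb (sn n))) => //.
by move=> n; exact: lincomb_measurable.
Qed.

Lemma limit_var_controlled Y : lincomb_limit Y -> var_controlled P Y.
Proof.
move=> [sn snY]; apply: (var_controlled_lim (Yn := fun n => lincomb (sn n))) => //.
by move=> n; exact: lincomb_measurable.
Qed.

Lemma limit_L2 Y : lincomb_limit Y -> Y \in L2.
Proof.
by move=> lY; apply: var_controlled_L2; [exact: limit_measurable|exact: limit_var_controlled].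
Qed.

Lemma limit_at x : lincomb_limit (fun w => f w x).
Proof.
exists (fun=> [:: (1, x)]) => w; rewrite /lincomb.
by under eq_fun do rewrite big_seq1 mul1r; exact: cvg_cst.
Qed.

Lemma limitD Y Z : lincomb_limit Y -> lincomb_limit Z ->
  lincomb_limit (fun w => Y w + Z w).
Proof.
move=> [sn snY] [rn rnZ]; exists (fun n => sn n ++ rn n) => w.
rewrite /lincomb; under eq_fun do rewrite big_cat.
by apply: (@cvgD _ R^o); [exact: snY|exact: rnZ].
Qed.

Lemma limitZ (a : R) Y : lincomb_limit Y -> lincomb_limit (fun w => a * Y w).
Proof.
move=> [sn snY]; exists (fun n => [seq (a * z.1, z.2) | z <- sn n]) => w.
have E n : lincomb [seq (a * z.1, z.2) | z <- sn n] w = a * lincomb (sn n) w.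
  by rewrite /lincomb big_map mulr_sumr; apply: eq_bigr => z _; rewrite mulrA.
by under eq_fun do rewrite E; apply: cvgM; [exact: cvg_cst|exact: snY].
Qed.

Lemma limit_sum (I : Type) (r : seq I) (F : I -> T -> R) :
  (forall i, lincomb_limit (F i)) -> lincomb_limit (fun w => \sum_(i <- r) F i w).
Proof.
move=> lF; elim: r => [|i r IHr].
  exists (fun=> [::]) => w; rewrite big_nil /lincomb.
  by under eq_fun do rewrite big_nil; exact: cvg_cst.
by under eq_fun do rewrite big_cons; exact: limitD.
Qed.

Let e (n : nat) : R := n.+1%:R^-1.
Let e_neq0 n : e n != 0. Proof. by rewrite invr_eq0. Qed.
Let e_cvg : e n @[n --> \oo] --> 0. Proof. exact: cvg_harmonic. Qed.

(** First and second directional derivatives of the paths at [x0], the terms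
D(v) and Q(v) of the expansion. *)
Definition dir1 v (w : T) : R := bil 1%:M v (gradv (f w) x0).
Definition dir2 v (w : T) : R := quad (hessm (f w) x0) v.

Lemma limit_partial k : lincomb_limit (fun w => partial k (f w) x0).
Proof.
exists (fun n => [:: ((e n)^-1, x0 + e n *: delta_mx 0 k); (- (e n)^-1, x0)]) => w.
have := partial_cvg (k := k) oU (fC2 w).1 Ux0 e_neq0 e_cvg.
apply: cvg_trans; apply: near_eq_cvg; apply: nearW => n.
by rewrite /lincomb !big_cons big_nil/=; ring.
Qed.

Lemma limit_hessm a b : lincomb_limit (fun w => hessm (f w) x0 a b).
Proof.
exists (fun n => [:: ((e n) ^- 2, x0 + e n *: delta_mx 0 a + e n *: delta_mx 0 b);
  (- (e n) ^- 2, x0 + e n *: delta_mx 0 a);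
  (- (e n) ^- 2, x0 + e n *: delta_mx 0 b); ((e n) ^- 2, x0)]) => w.
have := second_difference_cvg (a := a) (b := b) oU (fC2 w) Ux0 e_neq0 e_cvg.
apply: cvg_trans; apply: near_eq_cvg; apply: nearW => n.
by rewrite /lincomb !big_cons big_nil/= /second_difference; ring.
Qed.

Lemma dir1E v : dir1 v = fun w => \sum_k v 0 k * partial k (f w) x0.
Proof.
apply/funext => w; rewrite /dir1 bil1E; apply: eq_bigr => k _.
by rewrite mxE.
Qed.

Lemma dir2E v : dir2 v = fun w => \sum_a \sum_b v 0 a * v 0 b * hessm (f w) x0 a b.
Proof.
apply/funext => w; rewrite /dir2 quadE bilE; apply: eq_bigr => a _.
by apply: eq_bigr => b _; rewrite mulrAC.
Qed.

Lemma limit_dir1 v : lincomb_limit (dir1 v).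
Proof. by rewrite dir1E; apply: limit_sum => k; exact/limitZ/limit_partial. Qed.

Lemma limit_dir2 v : lincomb_limit (dir2 v).
Proof.
rewrite dir2E; apply: limit_sum => a; apply: limit_sum => b.
exact/limitZ/limit_hessm.
Qed.

Lemma dir1Z (h : R) v w : dir1 (h *: v) w = h * dir1 v w.
Proof. by rewrite /dir1 bilZl. Qed.

Lemma dir2Z (h : R) v w : dir2 (h *: v) w = h ^+ 2 * dir2 v w.
Proof. by rewrite /dir2 quadZ. Qed.

Definition taylor_rem v (w : T) : R :=
  f w (x0 + v) - f w x0 - dir1 v w - 2^-1 * dir2 v w.

Lemma taylor_rem_o2 w : is_o2 (fun v => taylor_rem v w).
Proof. by move=> eps eps0; apply/nbhs_norm0P; exact: (taylor2 oU (fC2 w) Ux0 eps0). Qed.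

Lemma limit_taylor_rem v : lincomb_limit (taylor_rem v).
Proof.
have -> : taylor_rem v = fun w => f w (x0 + v) + (-1) * f w x0
    + (-1) * dir1 v w + (- 2^-1) * dir2 v w.
  by apply/funext => w; rewrite /taylor_rem; ring.
apply: limitD; last exact/limitZ/limit_dir2.
apply: limitD; last exact/limitZ/limit_dir1.
by apply: limitD; [exact: limit_at|apply: limitZ; exact: limit_at].
Qed.

(** If this failed there would be increments [v n], tending to zero, violating the
bound. The remainders at [v n] divided by [`|v n| ^+ 2] tend to zero pathwise and
are variance-controlled, as limits of linear combinations of the field, so they
tend to zero in mean square, which contradicts the choice of [v n]. *)
Lemma taylor_rem_L2 (eps : R) : 0 < eps ->
  \forall v \near (0 : 'rV[R]_d),
    ip (taylor_rem v) (taylor_rem v) <= eps * `|v| ^+ 4.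
Proof.
move=> eps0; apply: contrapT => not_near.
have bad n : exists v, `|v| < e n /\
    eps * `|v| ^+ 4 < ip (taylor_rem v) (taylor_rem v).
  apply: contrapT => no; apply: not_near; apply/nbhs_norm0P.
  exists (e n); first by rewrite /= invr_gt0.
  move=> v vn; rewrite leNgt; apply/negP => lt; apply: no.
  by exists v.
pose v n := projT1 (cid (bad n)).
have [vlt vbad] : (forall n, `|v n| < e n) /\ (forall n, eps * `|v n| ^+ 4 <
    ip (taylor_rem (v n)) (taylor_rem (v n))).
  by split => n; rewrite /v; case: cid => ? [].
have v0 n : v n != 0.
  apply: contraPneq (vbad n) => ->; rewrite normr0 expr0n/= mulr0.
  rewrite (_ : taylor_rem 0 = fun w => 0 * f w x0); last first.
    apply/funext => w; rewrite /taylor_rem addr0 subrr.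
    have <- : 0 *: (0 : 'rV[R]_d) = 0 by rewrite scale0r.
    by rewrite dir1Z dir2Z expr0n/= !mul0r mulr0 !subr0.
  have l0 := limit_L2 (limit_at x0).
  by rewrite ipZl ?mul0r ?ltxx//; exact: L2Z.
pose Yn n w := `|v n| ^- 2 * taylor_rem (v n) w.
have lY n : lincomb_limit (Yn n) by exact/limitZ/limit_taylor_rem.
have cY w : Yn n w @[n --> \oo] --> 0.
  apply/cvgr0Pnorm_le => eta eta0.
  have [del /= del0 delP] := (nbhs_norm0P).1 (taylor_rem_o2 w eta0).
  near=> n; rewrite /Yn normrM normfV normrX normr_id.
  rewrite ler_pdivrMl ?exprn_gt0 ?normr_gt0// [leRHS]mulrC; apply: delP => /=.
  apply: lt_trans (vlt n) _; apply: le_lt_trans (ler_norm _) _.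
  by near: n; exact: (cvgr0_norm_lt _ e_cvg).
have [n _ /(_ n (leqnn n))] := var_controlled_cvg0
  (fun n => limit_measurable (lY n)) (fun n => limit_var_controlled (lY n)) cY eps0.
apply/negP; rewrite -ltNge.
have l2 := limit_L2 (limit_taylor_rem (v n)).
rewrite /Yn ipZl//; last exact: L2Z.
rewrite ipC ipZl// mulrA -invfM -exprD ltr_pdivlMl ?exprn_gt0 ?normr_gt0//.
by rewrite mulrC.
Unshelve. all: by end_near. Qed.

(** The Cauchy-Schwarz inequality turns the bound on second moments, of order
[o(|v|^4)], into one of order [o(|v|^2)] on inner products. *)
Lemma taylor_rem_ip Y : Y \in L2 -> is_o2 (fun v => ip (taylor_rem v) Y).
Proof.
move=> Y2 eps eps0.
have c0 : 0 < ip Y Y + 1 by rewrite ltr_wpDl// ip_ge0.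
have eps'0 : 0 < eps ^+ 2 / (ip Y Y + 1) by rewrite divr_gt0// exprn_gt0.
near=> v.
have r2 := limit_L2 (limit_taylor_rem v).
have h : ip (taylor_rem v) (taylor_rem v) <= eps ^+ 2 / (ip Y Y + 1) * `|v| ^+ 4.
  by near: v; exact: taylor_rem_L2.
rewrite -ler_sqr ?nnegrE ?mulr_ge0 ?exprn_ge0 ?(ltW eps0)//.
rewrite real_normK ?num_real// (le_trans (cauchy_schwarz r2 Y2))//.
apply: (@le_trans _ _ (eps ^+ 2 / (ip Y Y + 1) * `|v| ^+ 4 * (ip Y Y + 1))).
  apply: ler_pM => //; [exact: ip_ge0|exact: ip_ge0|by rewrite lerDl].
by rewrite mulrAC divfK ?gt_eqF// exprMn -exprM.
Unshelve. all: by end_near. Qed.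

(** Exact as it stands; [taylor_rem_ip] makes it a second-order expansion of the
covariance. *)
Lemma ip_expansion Y v : Y \in L2 ->
  ip (fun w => f w (x0 + v)) Y =
    ip (fun w => f w x0) Y + ip (dir1 v) Y + 2^-1 * ip (dir2 v) Y
    + ip (taylor_rem v) Y.
Proof.
move=> Y2; have f2 := limit_L2 (limit_at x0).
have D2 := limit_L2 (limit_dir1 v); have Q2 := limit_L2 (limit_dir2 v).
have r2 := limit_L2 (limit_taylor_rem v).
rewrite -ipZl// -ipDl// -ipDl//; [|exact: L2D|exact: L2Z].
rewrite -ipDl//; last by apply: L2D; [exact: L2D|exact: L2Z].
by congr (ip _ _); apply/funext => w; rewrite /taylor_rem; ring.
Qed.

Lemma ip_dir1Z (h : R) v Y : Y \in L2 -> ip (dir1 (h *: v)) Y = h * ip (dir1 v) Y.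
Proof.
move=> Y2; rewrite -ipZl//; last exact: limit_L2 (limit_dir1 v).
by congr (ip _ _); apply/funext => w; rewrite dir1Z.
Qed.

Lemma ip_dir2Z (h : R) v Y : Y \in L2 ->
  ip (dir2 (h *: v)) Y = h ^+ 2 * ip (dir2 v) Y.
Proof.
move=> Y2; rewrite -ipZl//; last exact: limit_L2 (limit_dir2 v).
by congr (ip _ _); apply/funext => w; rewrite dir2Z.
Qed.

Lemma ip_mean Y : ip Y (cst 1) = fine ('E_P[Y])%E.
Proof.
by congr (fine 'E_P[_]); apply/funext => w; rewrite /= mulr1.
Qed.

(** The mean of the field vanishes identically, so every coefficient of its
expansion does. *)
Lemma mean_dir1 v : ('E_P[dir1 v] = 0)%E.
Proof.
have D2 := limit_L2 (limit_dir1 v).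
rewrite -[LHS]fineK ?expectation_fin_num ?L2_Lfun1// -ip_mean; congr EFin.
have one2 := L2_cst P (1 : R).
apply: (@o2_line_eq0 _ _ (2^-1 * ip (dir2 v) (cst 1)) _).1.
have := is_o2Z (-1) (is_o2_line v (taylor_rem_ip one2)).
congr is_o2; apply/funext => h.
have := ip_expansion (h *: v) one2.
rewrite ip_dir1Z// ip_dir2Z// !ip_mean !meanf /=; lra.
Qed.

Local Notation f0 := (fun w => f w x0).

(** The variance at [x0 + h *: v] is expanded in [h] in both factors; as it is
constant, its coefficients of order 1 and 2, which are [2 * a] and [b + c] below,
vanish. *)
Lemma ip_dir_f0 v :
  ip (dir1 v) f0 = 0 /\ ip (dir2 v) f0 = - ip (dir1 v) (dir1 v).
Proof.
have f2 := limit_L2 (limit_at x0).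
have D2 := limit_L2 (limit_dir1 v); have Q2 := limit_L2 (limit_dir2 v).
set a := ip (dir1 v) f0; set b := ip (dir2 v) f0; set c := ip (dir1 v) (dir1 v).
suff : is_o2 (fun h : R^o => h * (2 * a) + h ^+ 2 * (b + c)).
  by move=> /o2_line_eq0[a0 bc0]; split; lra.
pose q := ip (dir2 v) (dir1 v).
have o1 := is_o2_line v (taylor_rem_ip f2).
have o2 := is_o2_mulh (is_o2_line v (taylor_rem_ip D2)).
have o3 := is_o2_mulh (is_o2_mulh (is_o2_line v (taylor_rem_ip Q2))).
have o4 : is_o2 (fun h : R^o => ip (taylor_rem (h *: v)) (taylor_rem (h *: v))).
  apply: (@is_o2_line _ _ (fun u => ip (taylor_rem u) (taylor_rem u))).
  move=> e0 e00.
  have near1 : \forall u \near (0 : 'rV[R]_d), `|u| <= 1.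
    by apply/nbhs_norm0P; exists 1 => //= u /ltW.
  apply: filterS2 near1 (taylor_rem_L2 e00) => u u1 /=.
  rewrite ger0_norm ?ip_ge0// => /le_trans; apply.
  apply: ler_wpM2l; first exact: ltW.
  by rewrite -[leRHS]mulr1 (exprD _ 2 2) ler_wpM2l ?exprn_ge0// expr_le1.
have o5 : is_o2 (fun h : R^o => h ^+ 3) by exact: is_o2_cube.
have o6 := is_o2_mulh o5.
have := is_o2D (is_o2D (is_o2D (is_o2Z (-2) o1) (is_o2Z (-2) o2))
  (is_o2D (is_o2Z (-1) o3) (is_o2Z (-1) o4)))
  (is_o2D (is_o2Z (- q) o5) (is_o2Z (- (4^-1 * ip (dir2 v) (dir2 v))) o6)).
congr is_o2; apply/funext => h.
have r2 := limit_L2 (limit_taylor_rem (h *: v)).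
have fh2 := limit_L2 (limit_at (x0 + h *: v)).
have eF : 1 = ip (fun w => f w (x0 + h *: v)) f0
    + h * ip (fun w => f w (x0 + h *: v)) (dir1 v)
    + 2^-1 * (h ^+ 2 * ip (fun w => f w (x0 + h *: v)) (dir2 v))
    + ip (fun w => f w (x0 + h *: v)) (taylor_rem (h *: v)).
  rewrite -[LHS](varf (x0 + h *: v)) [LHS](ip_expansion _ fh2).
  rewrite ip_dir1Z// ip_dir2Z//.
  by congr (_ + _ * _ + _ * (_ * _) + _); exact: ipC.
move: eF; rewrite !(ip_expansion (h *: v))// !(ip_dir1Z, ip_dir2Z)//.
rewrite varf (ipC P f0 (dir1 v)) (ipC P f0 (dir2 v)) (ipC P (dir1 v) (dir2 v)).
rewrite (ipC P f0 (taylor_rem _)) (ipC P (dir1 v) (taylor_rem _)).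
rewrite (ipC P (dir2 v) (taylor_rem _)) -/a -/b -/c -/q.
lra.
Qed.

(** By [taylor_rem_ip] the remainder contributes o(|v|) to the increment, so the
derivative may be taken under the expectation. *)
Lemma is_derive_ip Y v : Y \in L2 ->
  is_derive x0 v (fun x => ip (fun w => f w x) Y : R^o) (ip (dir1 v) Y).
Proof.
move=> Y2; pose phi x : R^o := ip (fun w => f w x) Y.
suff cv : h^-1 *: ((phi \o shift x0) (h *: v) - phi x0) @[h --> (0 : R)^']
    --> ip (dir1 v) Y.
  by split; [apply/cvg_ex; exists (ip (dir1 v) Y)|exact: cvg_lim].
have oG : is_o2 (fun h : R^o => ip (taylor_rem (h *: v)) Y).
  by apply: (@is_o2_line _ _ (fun u => ip (taylor_rem u) Y)); exact: taylor_rem_ip.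
pose b := 2^-1 * ip (dir2 v) Y.
have b0 : 0 < `|b| + 1 by rewrite ltr_wpDl.
apply/cvgrPdistC_le => e0 e00; near=> h.
have h0 : h != 0 by near: h; exact: nbhs_dnbhs_neq.
have -> : h^-1 *: ((phi \o shift x0) (h *: v) - phi x0) - ip (dir1 v) Y =
    h * b + h^-1 * ip (taylor_rem (h *: v)) Y.
  rewrite /= /phi [h *: v + x0]addrC (ip_expansion (h *: v) Y2).
  rewrite ip_dir1Z// ip_dir2Z// /b /GRing.scale/=; field.
  by rewrite h0.
have h1 : `|h| * (`|b| + 1) <= e0.
  rewrite -ler_pdivlMr//; near: h; apply: dnbhs0_le; exact: divr_gt0.
have h2 : `|ip (taylor_rem (h *: v)) Y| <= 1 * `|h| ^+ 2.
  by near: h; apply: nbhs_dnbhs; exact: oG.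
rewrite (le_trans (ler_normD _ _))// [`|h * b|]normrM [`|h^-1 * _|]normrM normfV.
have : `|h|^-1 * `|ip (taylor_rem (h *: v)) Y| <= `|h|.
  rewrite ler_pdivrMl ?normr_gt0//; move: h2; rewrite mul1r expr2; exact.
lra.
Unshelve. all: by end_near. Qed.

(** The first-order term of the covariance vanishes and its second-order term is
[- ip (dir1 v) (dir1 v) / 2], by [ip_dir_f0]. *)
Lemma denominator_o2 :
  is_o2 (fun v => (1 - ip (fun w => f w (x0 + v)) f0)
                  - 2^-1 * ip (dir1 v) (dir1 v)).
Proof.
have f2 := limit_L2 (limit_at x0).
have := is_o2Z (-1) (taylor_rem_ip f2); congr is_o2; apply/funext => v.
have [Df Qf] := ip_dir_f0 v.
rewrite (ip_expansion v f2) Df Qf varf; lra.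
Qed.

(** * Regression on the field and its gradient at a point *)

Variable E : 'M[R]_d.
Hypothesis Eunit : E \in unitmx.

(** The gradient in the basis formed by the rows of [E]. *)
Definition gradE (w : T) : 'rV[R]_d := gradv (f w) x0 *m E^T.
Definition LamE : 'M[R]_d :=
  \matrix_(k, l) ip (fun w => gradE w 0 k) (fun w => gradE w 0 l).
Hypothesis Lamunit : LamE \in unitmx.

(** The residual of the linear regression of [Y] on the field and its gradient
at [x0]. As these are uncorrelated and the field has variance one, the two
regressions are subtracted separately. *)
Definition regrem Y (w : T) : R :=
  Y w - ip Y f0 * f w x0 -
  ((\row_k ip Y (fun w' => gradE w' 0 k)) *m invmx LamE *m (gradE w)^T) 0 0.

Lemma gradE_dir1 k : (fun w => gradE w 0 k) = dir1 (row k E).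
Proof.
apply/funext => w; rewrite /dir1 bilC ?trmx1// bil1E /gradE mxE.
by apply: eq_bigr => j _; rewrite !mxE.
Qed.

Lemma limit_gradE k : lincomb_limit (fun w => gradE w 0 k).
Proof. by rewrite gradE_dir1; exact: limit_dir1. Qed.

Lemma dir1_mulE u : dir1 (u *m E) = fun w => \sum_k u 0 k * gradE w 0 k.
Proof.
apply/funext => w; rewrite -bil1E /dir1 /bil !mulmx1 /gradE.
by rewrite trmx_mul trmxK mulmxA.
Qed.

Lemma ip_dir1_gradE u l :
  ip (dir1 (u *m E)) (fun w => gradE w 0 l) = (u *m LamE) 0 l.
Proof.
have G2 k := limit_L2 (limit_gradE k).
rewrite dir1_mulE ip_suml//; last by move=> k; exact: L2Z.
by rewrite mxE; apply: eq_bigr => k _; rewrite ipZl// mxE.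
Qed.

Lemma ip_dir1_dir1 u : ip (dir1 (u *m E)) (dir1 (u *m E)) = quad LamE u.
Proof.
have G2 k := limit_L2 (limit_gradE k).
rewrite [in RHS]/quad mxE [X in ip _ X]dir1_mulE ipC ip_suml//; last 2 first.
- by move=> k; exact: L2Z.
- exact: limit_L2 (limit_dir1 _).
apply: eq_bigr => l _; rewrite ipZl//; last exact: limit_L2 (limit_dir1 _).
by rewrite ipC ip_dir1_gradE mulrC [X in _ = _ * X]mxE.
Qed.

Lemma regremD Y Z w : Y \in L2 -> Z \in L2 ->
  regrem (fun w => Y w + Z w) w = regrem Y w + regrem Z w.
Proof.
move=> Y2 Z2; have f2 := limit_L2 (limit_at x0).
have G2 k := limit_L2 (limit_gradE k).
rewrite /regrem ipDl//.
have -> : \row_k ip (fun w => Y w + Z w) (fun w' => gradE w' 0 k) =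
    \row_k ip Y (fun w' => gradE w' 0 k) + \row_k ip Z (fun w' => gradE w' 0 k).
  by apply/rowP => k; rewrite !mxE ipDl.
by rewrite !mulmxDl [X in _ - X = _]mxE; ring.
Qed.

Lemma regremZ (a : R) Y w : Y \in L2 ->
  regrem (fun w => a * Y w) w = a * regrem Y w.
Proof.
move=> Y2; have f2 := limit_L2 (limit_at x0).
have G2 k := limit_L2 (limit_gradE k).
rewrite /regrem ipZl//.
have -> : \row_k ip (fun w => a * Y w) (fun w' => gradE w' 0 k) =
    a *: \row_k ip Y (fun w' => gradE w' 0 k).
  by apply/rowP => k; rewrite !mxE ipZl.
by rewrite -!scalemxAl [X in _ - X = _]mxE; ring.
Qed.

Lemma regrem_sum (I : Type) (r : seq I) (F : I -> T -> R) w :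
  (forall i, F i \in L2) ->
  regrem (fun w => \sum_(i <- r) F i w) w = \sum_(i <- r) regrem (F i) w.
Proof.
move=> F2; elim: r => [|i r IHr].
  have one2 := L2_cst P (1 : R).
  have -> : (fun w => \sum_(i <- [::]) F i w) = (fun w => 0 * cst 1 w).
    by apply/funext => w'; rewrite big_nil mul0r.
  by rewrite regremZ// big_nil mul0r.
rewrite big_cons -IHr -regremD//; last exact: L2_sum.
by congr regrem; apply/funext => w'; rewrite big_cons.
Qed.

Lemma regrem_f0 w : regrem f0 w = 0.
Proof.
rewrite /regrem varf mul1r subrr.
have -> : \row_k ip f0 (fun w' => gradE w' 0 k) = 0.
  by apply/rowP => k; rewrite !mxE ipC gradE_dir1 (ip_dir_f0 _).1.
by rewrite !mul0mx mxE subrr.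
Qed.

Lemma regrem_dir1 v w : regrem (dir1 v) w = 0.
Proof.
rewrite -(mulmxKV Eunit v); set u := v *m invmx E.
rewrite /regrem (ip_dir_f0 _).1 mul0r subr0.
have -> : \row_k ip (dir1 (u *m E)) (fun w' => gradE w' 0 k) = u *m LamE.
  by apply/rowP => k; rewrite mxE ip_dir1_gradE.
rewrite mulmxK// dir1_mulE -bil1E /bil mulmx1; apply/eqP.
by rewrite subr_eq0.
Qed.

(** Since [regrem] is linear and vanishes on the field and on its gradient at [x0],
the second-order term and the remainder of the Taylor expansion alone contribute.
For a fixed outcome the residual of the remainder is a combination of
[taylor_rem v w] and of inner products with [taylor_rem v], all of them
o(|v|^2). *)
Lemma numerator_o2 w :
  is_o2 (fun v => regrem (fun w => f w (x0 + v)) w - 2^-1 * regrem (dir2 v) w).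
Proof.
have f2 := limit_L2 (limit_at x0).
have G2 k := limit_L2 (limit_gradE k).
suff : is_o2 (fun v => regrem (taylor_rem v) w).
  congr is_o2; apply/funext => v.
  have D2 := limit_L2 (limit_dir1 v); have Q2 := limit_L2 (limit_dir2 v).
  have r2 := limit_L2 (limit_taylor_rem v).
  have -> : (fun w => f w (x0 + v)) = fun w =>
      ((f w x0 + dir1 v w) + 2^-1 * dir2 v w) + taylor_rem v w.
    by apply/funext => w'; rewrite /taylor_rem; ring.
  have fD2 := L2D f2 D2; have q2 := L2Z 2^-1 Q2; have s2 := L2D fD2 q2.
  rewrite (regremD w s2 r2) (regremD w fD2 q2) (regremD w f2 D2) regremZ//.
  by rewrite regrem_f0 regrem_dir1; ring.
have := is_o2D (is_o2D (@taylor_rem_o2 w) (is_o2Z (- f w x0) (taylor_rem_ip f2)))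
  (is_o2_sum (index_enum 'I_d) (fun k => is_o2Z (- (invmx LamE *m (gradE w)^T) k 0)
    (taylor_rem_ip (G2 k)))).
congr is_o2; apply/funext => v; rewrite /regrem -mulmxA [X in _ = _ - X]mxE.
rewrite mulNr mulrC; congr (_ + _); rewrite -sumrN; apply: eq_bigr => k _.
by rewrite mulNr mulrC !mxE.
Qed.

End random_taylor.

(** * Ratio of two quadratic expansions *)

Section ratio.
Context {R : realType} {d : nat}.
Implicit Types (A : 'M[R]_d) (u v : 'rV[R]_d).

Lemma quad_norm_le A : exists2 K : R, 0 < K & forall u, `|quad A u| <= K * `|u| ^+ 2.
Proof.
have [C C0 CA] := mulmx_norm_le A.
have K0 : 0 < d.+1%:R * C by rewrite mulr_gt0.
exists (d.+1%:R * C) => // u.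
have -> : quad A u = bil 1%:M u (u *m A).
  by rewrite bilC ?trmx1// /bil mulmx1.
have bnd k : `|(u *m A) 0 k| <= C * `|u|.
  exact: le_trans (coord_le_norm _ _) (CA u).
apply: (le_trans (bil1_le u bnd)).
rewrite expr2 !mulrA ler_wpM2r// ler_wpM2r// ler_wpM2r ?(ltW C0)//.
by rewrite ler_nat.
Qed.

Variables (L : 'M[R]_d).
Hypotheses (Lpsd : psdmx L) (Lunit : L \in unitmx).
Let S := sqrtmx L.

Lemma sqrtmx_sym : S^T = S.
Proof. by have [[]] := sqrtmxP Lpsd. Qed.

Lemma sqrtmx_sqr : S *m S = L.
Proof. by have [] := sqrtmxP Lpsd. Qed.

Lemma sqrtmx_unit : S \in unitmx.
Proof. by move: Lunit; rewrite -sqrtmx_sqr unitmx_mul => /andP[]. Qed.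

Lemma quad_sqrtmx u : quad L u = norm2 (u *m S) ^+ 2.
Proof.
rewrite norm2_sqr /quad mulmx1 trmx_mul sqrtmx_sym -{1}sqrtmx_sqr.
by rewrite !mulmxA.
Qed.

Lemma quad_ge_norm : exists2 mu : R, 0 < mu & forall u, mu * `|u| ^+ 2 <= quad L u.
Proof.
have [C C0 CS] := mulmx_norm_le (invmx S).
exists (C ^- 2) => [|u]; first by rewrite invr_gt0 exprn_gt0.
rewrite ler_pdivrMl ?exprn_gt0// quad_sqrtmx.
have := CS (u *m S); rewrite mulmxK ?sqrtmx_unit// => h.
rewrite -exprMn lerXn2r ?nnegrE//; first by rewrite mulr_ge0 ?norm2_ge0// ltW.
by apply: (le_trans h); rewrite ler_wpM2l ?norm_le_norm2// ltW.
Qed.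

Lemma quad_gt0 u : u != 0 -> 0 < quad L u.
Proof.
move=> u0; have [mu mu0 muL] := quad_ge_norm.
by apply: lt_le_trans (muL u); rewrite mulr_gt0// exprn_gt0// normr_gt0.
Qed.

Variable A : 'M[R]_d.

(** The substitution y = u S turns the denominator into the squared Euclidean
norm of y, and homogeneity normalizes y. *)
Lemma quad_ratio u : quad A u / quad L u =
  quad (invmx S *m A *m invmx S) ((norm2 (u *m S))^-1 *: (u *m S)).
Proof.
rewrite quadZ exprVn -quad_sqrtmx mulrC; congr (_ * _).
have sS : (invmx S)^T = invmx S by rewrite trmx_inv sqrtmx_sym.
by rewrite -[X in _ *m X]sS quad_conj mulmxK ?sqrtmx_unit.
Qed.

(** The denominator is bounded below by a multiple of [`|u| ^+ 2], because
[quad L] is definite, so errors of smaller order than [`|u| ^+ 2] in the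
numerator and the denominator do not affect the limit. *)
Lemma ratio_near (N D : 'rV[R]_d -> R) (e : R) :
  is_o2 (fun u => N u - 2^-1 * quad A u) ->
  is_o2 (fun u => D u - 2^-1 * quad L u) -> 0 < e ->
  \forall u \near (0 : 'rV[R]_d), u != 0 ->
    `|N u / D u - quad A u / quad L u| <= e.
Proof.
move=> oN oD e0.
have [mu mu0 muL] := quad_ge_norm; have [K K0 KA] := quad_norm_le A.
have c0 : 0 < 1 + K / mu by rewrite addr_gt0// divr_gt0.
pose e' := Num.min (mu / 4) (e * mu / (4 * (1 + K / mu))).
have e'0 : 0 < e' by rewrite lt_min !divr_gt0 ?mulr_gt0.
have e'mu : e' <= mu / 4 by rewrite ge_min lexx.
have e'e : 4 * e' * (1 + K / mu) <= e * mu.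
  rewrite mulrAC -ler_pdivlMl ?mulr_gt0// mulrC.
  by rewrite ge_min lexx orbT.
apply: filterS2 (oN _ e'0) (oD _ e'0) => u Nu Du u0.
set a := quad A u in Nu *; set b := quad L u in Du *.
set q := `|u| ^+ 2 in Nu Du.
have q0 : 0 < q by rewrite exprn_gt0// normr_gt0.
have b0 : 0 < b by exact: quad_gt0.
have qb : mu * q <= b by exact: muL.
have aq : `|a| <= K * q by exact: KA.
pose al := 2 * N u - a; pose be := 2 * D u - b.
have alq : `|al| <= 2 * e' * q.
  have -> : al = 2 * (N u - 2^-1 * a) by rewrite /al; lra.
  by rewrite normrM ger0_norm// -mulrA ler_wpM2l.
have beq : `|be| <= 2 * e' * q.
  have -> : be = 2 * (D u - 2^-1 * b) by rewrite /be; lra.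
  by rewrite normrM ger0_norm// -mulrA ler_wpM2l.
have e'q : 2 * e' * q <= b / 2.
  have : e' * q <= mu / 4 * q by rewrite ler_wpM2r// ltW.
  lra.
have bbe : b / 2 <= b + be.
  by have := ler_norm (- be); rewrite normrN; lra.
have bbe0 : 0 < b + be by apply: lt_le_trans bbe; rewrite divr_gt0.
have -> : N u / D u - a / b = (al * b - a * be) / (b * (b + be)).
  have -> : N u = (al + a) / 2 by rewrite /al; lra.
  have -> : D u = (b + be) / 2 by rewrite /be; lra.
  by field; rewrite !gt_eqF//= addrC.
rewrite normrM [`|(_ * _)^-1|]ger0_norm; last by rewrite invr_ge0 mulr_ge0 ?ltW.
rewrite ler_pdivrMr ?mulr_gt0//.
apply: (@le_trans _ _ (2 * e' * q * (b + `|a|))).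
  rewrite (le_trans (ler_normB _ _))// !normrM (ger0_norm (ltW b0)) mulrDr.
  rewrite lerD//; first by rewrite ler_wpM2r// ltW.
  by rewrite mulrC ler_wpM2r.
have ab : b + `|a| <= (1 + K / mu) * b.
  rewrite mulrDl mul1r lerD2l (le_trans aq)// -mulrA ler_wpM2l ?(ltW K0)//.
  by rewrite ler_pdivlMl.
apply: (@le_trans _ _ (2 * e' * q * ((1 + K / mu) * b))).
  by rewrite ler_wpM2l// !mulr_ge0// ltW.
apply: (@le_trans _ _ (e * (b * (b / 2)))); last first.
  by rewrite ler_wpM2l ?(ltW e0)// ler_wpM2l ?(ltW b0).
have -> : 2 * e' * q * ((1 + K / mu) * b) = 4 * e' * (1 + K / mu) * q * (b / 2).
  by field; rewrite gt_eqF.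
rewrite [leRHS]mulrA ler_wpM2r ?divr_ge0 ?(ltW b0)//.
apply: (@le_trans _ _ (e * mu * q)); first by rewrite ler_wpM2r// ltW.
by rewrite -mulrA ler_wpM2l// ltW.
Qed.

End ratio.

(** * Changes on a negligible event *)

Section almost_sure.
Context {dT : measure_display} {T : measurableType dT} {R : realType}.
Variable P : probability T R.
Implicit Types (Y Z : T -> R).
Variable N : set T.
Hypotheses (mN : measurable N) (N0 : P N = 0%E).

Lemma expectation_off Y Z : (forall w, ~ N w -> Y w = Z w) ->
  ('E_P[Y] = 'E_P[Z])%E.
Proof.
move=> YZ; rewrite unlock; apply: (eq_integral_off_negligible mN N0) => w Nw.
by rewrite YZ.
Qed.

Lemma covariance_off Y Z Y' Z' : Y' \in Lfun P 2%:E -> Z' \in Lfun P 2%:E ->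
  ('E_P[Z'] = 0)%E ->
  (forall w, ~ N w -> Y w = Y' w) -> (forall w, ~ N w -> Z w = Z' w) ->
  fine (covariance P Y Z) = ip P Y' Z'.
Proof.
move=> Y2 Z2 EZ YY ZZ.
have -> : covariance P Y Z = covariance P Y' Z'.
  rewrite unlock (expectation_off YY) (expectation_off ZZ).
  by apply: expectation_off => w Nw /=; rewrite !fctE/= YY// ZZ.
rewrite (covarianceE (L2_Lfun1 Y2) (L2_Lfun1 Z2) (Lfun2_mul_Lfun1 Y2 Z2)).
by rewrite EZ mule0 sube0.
Qed.

Lemma probability_off (A B : set T) : measurable A -> measurable B ->
  (forall w, ~ N w -> A w <-> B w) -> P A = P B.
Proof.
move=> mA mB AB; rewrite -(setIT A) -(setIT B) -!integral_indic//.
apply: (eq_integral_off_negligible mN N0) => w /AB ABw.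
rewrite !indicE; congr (_%:R%:E)%R; congr nat_of_bool.
by apply/idP/idP; rewrite !inE => /ABw.
Qed.

Lemma var_controlled_off Y Z : measurable_fun [set: T] Y ->
  measurable_fun [set: T] Z -> (forall w, ~ N w -> Y w = Z w) ->
  var_controlled P Y -> var_controlled P Z.
Proof.
move=> mY mZ YZ vY e e0 half.
rewrite -(@eq_integral_off_negligible _ _ _ P (fun w => (Y w ^+ 2)%:E) _ N)//.
  have PE : P [set w | `|Y w| < e] = P [set w | `|Z w| < e].
    apply: probability_off; [exact: measurable_abs_lt|exact: measurable_abs_lt|].
    by move=> w Nw /=; rewrite YZ.
  by apply: vY; rewrite // PE.
by move=> w Nw; rewrite YZ.
Qed.

End almost_sure.

Lemma C2_on_cst (R : realType) (d : nat) (U : set 'rV[R]_d) :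
  C2_on U (fun=> 0 : R^o).
Proof.
have p0 j : partial j (fun=> 0 : R^o) = (fun=> 0 : R^o) :> ('rV[R]_d -> R^o).
  by apply/funext => x; rewrite /partial (derive_cst (0 : R^o)).
have c0 : C1_on U (fun=> 0 : R^o).
  by move=> j x _; split; [exact: derivable_cst|rewrite p0; exact: cst_continuous].
by split => // j; rewrite p0.
Qed.

Lemma invmx_uniq (R : comUnitRingType) n (A B : 'M[R]_n) :
  A *m B = 1%:M -> invmx A = B.
Proof.
by move=> AB; have [uA _] := mulmx1_unit AB; rewrite -[LHS]mulmx1 -AB mulKmx.
Qed.

(** * The field read in a chart *)

Section chart_field.
Context {R : realType} {d : nat} {M : topologicalType} {A : riemannian R d M}.
Context {dT : measure_display} {T : measurableType dT} (P : probability T R).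
Context {X : M -> {RV P >-> R}} (N : set T).
Hypotheses (mN : measurable N) (N0 : P N = 0%E)
  (NC2 : forall w, ~ N w -> C2_map A (fun p => X p w)).
Hypotheses (Xgaussian : gaussian_field X)
  (Xmean : forall p, ('E_P[X p] = 0)%E) (Xvar : forall p, ('V_P[X p] = 1)%E).
Variable i : chart A.
Local Notation L2 := (Lfun P 2%:E).
Local Notation ip := (ip P).
Local Notation U := (Defs.coord i @` dom i).

(** The field is set to zero on a negligible event outside of which its paths are
of class C^2, so that the derivatives of its paths are random variables. *)
Definition chart_field (w : T) (x : 'rV[R]_d) : R^o :=
  \1_(~` N) w * X (param i x) w.

Lemma chart_field_off w : ~ N w -> chart_field w = (fun x => X (param i x) w).
Proof.
by move=> Nw; apply/funext => x; rewrite /chart_field indicE mem_set// mul1r.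
Qed.

Lemma chart_field_measurable x : measurable_fun [set: T] (fun w => chart_field w x).
Proof.
apply: measurable_funM => //; apply: measurable_indic; exact: measurableC.
Qed.

Lemma chart_field_C2 w : C2_on U (chart_field w).
Proof.
have [Nw|Nw] := pselect (N w); last by rewrite chart_field_off//; exact: NC2.
rewrite (_ : chart_field w = fun=> 0); first exact: C2_on_cst.
by apply/funext => x; rewrite /chart_field indicE memNset ?mul0r//; apply.
Qed.

Lemma field_sqr p : (\int[P]_w (X p w ^+ 2)%:E = 1)%E.
Proof.
have := Xvar p; rewrite /variance unlock Xmean /= => <-.
rewrite [in RHS]unlock; apply: eq_integral => w _.
by rewrite !fctE/= subr0 expr2.
Qed.

Lemma field_L2 p : (X p : T -> R) \in L2.
Proof. by apply: L2P => //; rewrite field_sqr ltry. Qed.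

Lemma lincomb_field_controlled (s : seq (R * M)) :
  var_controlled P (fun w => \sum_(z <- s) z.1 * X z.2 w).
Proof.
apply: gaussian_var_controlled.
- by apply: L2_sum => z; apply: L2Z; exact: field_L2.
- have one2 := L2_cst P (1 : R).
  have S2 : (fun w => \sum_(z <- s) z.1 * X z.2 w) \in L2.
    by apply: L2_sum => z; apply: L2Z; exact: field_L2.
  rewrite -[LHS]fineK ?expectation_fin_num ?L2_Lfun1// -ip_mean; congr EFin.
  rewrite ip_suml//; last by move=> z; apply: L2Z; exact: field_L2.
  rewrite big1// => z _; rewrite ipZl//; last exact: field_L2.
  by rewrite ip_mean Xmean mulr0.
- have := Xgaussian (fun k : 'I_(size s) => (tnth (in_tuple s) k).2)
    (fun k : 'I_(size s) => (tnth (in_tuple s) k).1).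
  congr (is_gaussian P _); apply/funext => w.
  by rewrite [RHS]big_tnth.
Qed.

Lemma chart_field_controlled s : var_controlled P (lincomb chart_field s).
Proof.
apply: (@var_controlled_off _ _ _ _ N mN N0
  (fun w => \sum_(z <- [seq (z.1, param i z.2) | z <- s]) z.1 * X z.2 w)).
- by apply: measurable_sum => z; exact: measurable_funM.
- by apply: lincomb_measurable; exact: chart_field_measurable.
- move=> w Nw; rewrite /lincomb big_map; apply: eq_bigr => z _.
  by rewrite chart_field_off.
- exact: lincomb_field_controlled.
Qed.

Lemma chart_field_mean x : ('E_P[fun w => chart_field w x] = 0)%E.
Proof.
rewrite -(Xmean (param i x)); apply: (expectation_off mN N0) => w Nw.
by rewrite chart_field_off.
Qed.

Lemma ip_chart_field x Y Y' : (forall w, ~ N w -> Y w = Y' w) ->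
  ip (X (param i x)) Y = ip (fun w => chart_field w x) Y'.
Proof.
move=> YY; congr fine; apply: (expectation_off mN N0) => w Nw.
by rewrite chart_field_off// YY.
Qed.

Lemma chart_field_var x :
  ip (fun w => chart_field w x) (fun w => chart_field w x) = 1.
Proof.
rewrite -(@ip_chart_field x (X (param i x))); last first.
  by move=> w Nw; rewrite chart_field_off.
by apply: EFin_inj; rewrite ip_sqr ?field_L2// field_sqr.
Qed.

Lemma covfun_chart_field x y : covfun X (param i x) (param i y) =
  ip (fun w => chart_field w x) (fun w => chart_field w y).
Proof. by apply: ip_chart_field => w Nw; rewrite chart_field_off. Qed.

End chart_field.

(** * Derivatives, covariances and regression at a point *)

Section field_at_point.
Context {R : realType} {d : nat} {M : topologicalType} {A : riemannian R d M}.
Context {dT : measure_display} {T : measurableType dT} (P : probability T R).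
Context {X : M -> {RV P >-> R}} (N : set T).
Hypotheses (mN : measurable N) (N0 : P N = 0%E)
  (NC2 : forall w, ~ N w -> C2_map A (fun p => X p w)).
Hypotheses (Xgaussian : gaussian_field X)
  (Xmean : forall p, ('E_P[X p] = 0)%E) (Xvar : forall p, ('V_P[X p] = 1)%E).
Context {t : M} (F : frame A t).
Hypothesis Lunit : Lambda2 X F \in unitmx.
Local Notation L2 := (Lfun P 2%:E).
Local Notation ip := (ip P).
Let i := frame_chart F.
Let E := frame_mx F.
Let U := Defs.coord i @` dom i.
Let x0 := Defs.coord i t.
Let f := chart_field N (X := X) i.

Let oU : open U. Proof. exact: img_open. Qed.
Let Ux0 : U x0. Proof. by exists t => //; exact: frame_dom. Qed.
Let fC2 : forall w, C2_on U (f w). Proof. exact: chart_field_C2. Qed.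
Let mf : forall x, measurable_fun [set: T] (fun w => f w x).
Proof. exact: chart_field_measurable. Qed.
Let vf : forall s, var_controlled P (lincomb f s).
Proof. exact: chart_field_controlled. Qed.
Let meanf : forall x, ('E_P[fun w => f w x] = 0)%E.
Proof. exact: chart_field_mean. Qed.
Let varf : forall x, ip (fun w => f w x) (fun w => f w x) = 1.
Proof. exact: chart_field_var. Qed.
Let f_off w : ~ N w -> f w = (fun x => X (param i x) w).
Proof. exact: chart_field_off. Qed.
Let limL2 Y : lincomb_limit f Y -> Y \in L2.
Proof. exact: limit_L2. Qed.
Let param0 : param i x0 = t. Proof. by apply: coordK; exact: frame_dom. Qed.

Lemma frame_unit : E \in unitmx.
Proof. by have := frame_orthonormal F; rewrite -mulmxA => /mulmx1_unit[]. Qed.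

Lemma gradX_off w : ~ N w -> gradX X F w = gradE x0 f E w.
Proof.
move=> Nw; apply/rowP => k; rewrite mxE.
rewrite (_ : _ \o _ = f w); last by rewrite f_off.
have [_ ->] := C1_is_derive (row k E) oU (fC2 w).1 Ux0.
by have /(congr1 (fun g => g w)) := gradE_dir1 x0 f E k => ->.
Qed.

Let gL2 k : (fun w => gradE x0 f E w 0 k) \in L2.
Proof. by apply: limL2; exact: (limit_gradE oU Ux0 fC2). Qed.

Let gmean k : ('E_P[(fun w => gradE x0 f E w 0 k)%R] = 0)%E.
Proof. by rewrite gradE_dir1; exact: (mean_dir1 oU Ux0 fC2 mf vf meanf). Qed.

Lemma Lambda2E : Lambda2 X F = LamE P x0 f E.
Proof.
apply/matrixP => k l; rewrite !mxE.
by apply: (covariance_off mN N0 (gL2 k) (gL2 l) (gmean l)) => w Nw; rewrite gradX_off.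
Qed.

Let Lamunit : LamE P x0 f E \in unitmx. Proof. by rewrite -Lambda2E. Qed.

Lemma Lambda2_psd : psdmx (Lambda2 X F).
Proof.
rewrite Lambda2E; split; first by apply/matrixP => k l; rewrite !mxE ipC.
by move=> u; rewrite -(ip_dir1_dir1 oU Ux0 fC2 mf vf) ip_ge0.
Qed.

Lemma grad_covfun s : dom i s -> grad F (covfun X s) =
  \row_k ip (fun w => f w (Defs.coord i s)) (fun w => gradE x0 f E w 0 k).
Proof.
move=> ds; have fs2 := limL2 (limit_at f (Defs.coord i s)).
have covE : covfun X s \o param i =
    fun x => ip (fun w => f w x) (fun w => f w (Defs.coord i s)).
  apply/funext => x /=.
  by rewrite -[in LHS](coordK ds) (covfun_chart_field mN N0) ipC.
apply/rowP => k; rewrite [LHS]mxE [RHS]mxE gradE_dir1 ipC covE.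
by have [_ ->] := is_derive_ip oU Ux0 fC2 mf vf (row k E) fs2.
Qed.

(** The gradient of the covariance function is the covariance with the gradient,
which makes the numerator a regression residual. *)
Lemma Xbar_off s w : dom i s -> ~ N w ->
  Xbar X F s w = regrem P x0 f E (fun w => f w (Defs.coord i s)) w /
    (1 - ip (fun w => f w (Defs.coord i s)) (fun w => f w x0)).
Proof.
move=> ds Nw; rewrite /Xbar /regrem grad_covfun// Lambda2E gradX_off//.
have -> : covfun X s t = ip (fun w => f w (Defs.coord i s)) (fun w => f w x0).
  by rewrite -(coordK ds) -{1}param0 (covfun_chart_field mN N0) coordK.
by rewrite f_off// coordK// param0.
Qed.

(** Like [gradE], the version of the Hessian that is defined, and measurable in
the outcome, everywhere. *)
Definition hessE (w : T) : 'M[R]_d :=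
  E *m (\matrix_(a, b) (partial a (partial b (f w)) x0
       - \sum_(k < d) christoffel i x0 k a b * partial k (f w) x0)) *m E^T.

Lemma hess_off w : ~ N w -> hess F (fun p => X p w) = hessE w.
Proof. by move=> Nw; rewrite /hessE (f_off Nw). Qed.

Let hL2 k l : (fun w => hessE w k l) \in L2.
Proof.
have -> : (fun w => hessE w k l) = fun w => \sum_b \sum_a
    (E k a * E l b) * (hessm (f w) x0 a b
      - \sum_(k < d) christoffel i x0 k a b * partial k (f w) x0).
  apply/funext => w; rewrite /hessE mxE; apply: eq_bigr => b _.
  rewrite mxE mulr_suml; apply: eq_bigr => a _.
  by rewrite !mxE; ring.
apply: L2_sum => b; apply: L2_sum => a; apply: L2Z; apply: L2B.
  by apply: limL2; exact: (limit_hessm oU Ux0 fC2).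
by apply: L2_sum => j; apply: L2Z; apply: limL2; exact: (limit_partial oU Ux0 fC2).
Qed.

(** Block diagonal because a field of constant variance is uncorrelated with its
gradient at the same point. *)
Lemma crosscov_regressors :
  crosscov P (fun w => row_mx ((X t w)%:M : 'rV[R]_1) (gradX X F w))
             (fun w => row_mx ((X t w)%:M : 'rV[R]_1) (gradX X F w))
  = block_mx 1%:M 0 0 (Lambda2 X F).
Proof.
have f2 := limL2 (limit_at f x0).
have Xt (w : T) : ~ N w -> X t w = f w x0 by move=> Nw; rewrite f_off ?param0.
have lE (a : 'I_1) : (fun w => row_mx ((X t w)%:M : 'rV[R]_1) (gradX X F w) 0 (lshift d a))
    = X t.
  by apply/funext => w; rewrite row_mxEl mxE (ord1 a) eqxx mulr1n.
have rE (b : 'I_d) : (fun w => row_mx ((X t w)%:M : 'rV[R]_1) (gradX X F w) 0 (rshift 1 b))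
    = fun w => gradX X F w 0 b.
  by apply/funext => w; rewrite row_mxEr.
have f0g b : ip (fun w => f w x0) (fun w => gradE x0 f E w 0 b) = 0.
  by rewrite gradE_dir1 ipC (ip_dir_f0 oU Ux0 fC2 mf vf varf _).1.
rewrite -[LHS]submxK; congr block_mx; apply/matrixP => a b; rewrite !mxE.
- rewrite !lE (ord1 a) (ord1 b) eqxx mulr1n -(varf x0).
  exact: (covariance_off mN N0).
- rewrite lE rE -(f0g b).
  by apply: (covariance_off mN N0) => // w Nw; rewrite gradX_off.
- rewrite lE rE -(f0g a) ipC.
  by apply: (covariance_off mN N0) => // w Nw; rewrite gradX_off.
- by rewrite !rE.
Qed.

Lemma regression_remainder_off Y Y' w : Y' \in L2 ->
  (forall w, ~ N w -> Y w = Y' w) -> ~ N w ->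
  regression_remainder P Y (fun w => row_mx ((X t w)%:M : 'rV[R]_1) (gradX X F w)) w
  = regrem P x0 f E Y' w.
Proof.
move=> Y2 YY Nw; have f2 := limL2 (limit_at f x0).
have Xt w' : ~ N w' -> X t w' = f w' x0 by move=> Nw'; rewrite f_off ?param0.
rewrite /regression_remainder crosscov_regressors.
have -> : crosscov P (fun w' => (Y w')%:M : 'rV[R]_1)
     (fun w => row_mx ((X t w)%:M : 'rV[R]_1) (gradX X F w)) =
   row_mx (ip Y' (fun w => f w x0))%:M (\row_k ip Y' (fun w' => gradE x0 f E w' 0 k)).
  have YE (a : 'I_1) : (fun w => ((Y w)%:M : 'rV[R]_1) 0 a) = Y.
    by apply/funext => w'; rewrite mxE (ord1 a) eqxx mulr1n.
  rewrite -[LHS]hsubmxK; congr row_mx; apply/matrixP => a b; rewrite !mxE.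
    rewrite YE (ord1 a) (ord1 b) eqxx mulr1n.
    apply: (covariance_off mN N0) => // w' Nw'.
    by rewrite row_mxEl mxE eqxx mulr1n Xt.
  rewrite YE; apply: (covariance_off mN N0) => // w' Nw'.
  by rewrite row_mxEr gradX_off.
have -> : invmx (block_mx 1%:M 0 0 (Lambda2 X F) : 'M[R]_(1 + d)) =
    block_mx 1%:M 0 0 (invmx (Lambda2 X F)).
  apply: invmx_uniq; rewrite mulmx_block !(mulmx0, mul0mx, mulmx1, addr0, add0r).
  by rewrite mulmxV// -scalar_mx_block.
rewrite mul_row_block !(mulmx0, mul0mx, mulmx1, addr0, add0r).
rewrite tr_row_mx mul_row_col mxE opprD addrA /regrem YY// Lambda2E.
rewrite gradX_off// Xt//; congr (_ - _ - _).
by rewrite tr_scalar_mx -scalar_mxM mxE eqxx mulr1n.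
Qed.

Lemma Rtilde_off w k l : ~ N w ->
  Rtilde X F w k l = regrem P x0 f E (fun w => hessE w k l) w.
Proof.
move=> Nw; rewrite mxE; apply: (regression_remainder_off (hL2 k l) _ Nw).
by move=> w' Nw'; rewrite hess_off.
Qed.

(** The Christoffel terms of the Hessian form, for given [u], a fixed combination
of first derivatives, whose residual is zero; only the ordinary second
derivative along [u *m E] remains. *)
Lemma quad_Rtilde w u : ~ N w ->
  quad (Rtilde X F w) u = regrem P x0 f E (dir2 x0 f (u *m E)) w.
Proof.
move=> Nw; rewrite quadE bilE.
pose c : 'rV[R]_d := \row_k \sum_a \sum_b
  (u *m E) 0 a * christoffel i x0 k a b * (u *m E) 0 b.
have D2 := limL2 (limit_dir1 oU Ux0 fC2 c).
have Q2 := limL2 (limit_dir2 oU Ux0 fC2 (u *m E)).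
transitivity (regrem P x0 f E (fun w => \sum_k \sum_l (u 0 k * u 0 l) * hessE w k l) w).
  rewrite (regrem_sum oU Ux0 fC2 mf vf); last first.
    by move=> k; apply: L2_sum => l; exact: L2Z.
  apply: eq_bigr => k _; rewrite (regrem_sum oU Ux0 fC2 mf vf); last first.
    by move=> l; exact: L2Z.
  apply: eq_bigr => l _; rewrite (regremZ oU Ux0 fC2 mf vf)// Rtilde_off//.
  by rewrite mulrAC.
have -> : (fun w => \sum_k \sum_l (u 0 k * u 0 l) * hessE w k l) =
    fun w => dir2 x0 f (u *m E) w + (-1) * dir1 x0 f c w.
  apply/funext => w'.
  transitivity (quad (hessE w') u).
    rewrite quadE bilE; apply: eq_bigr => k _; apply: eq_bigr => l _.
    by rewrite mulrAC.
  have cE : dir1 x0 f c w' = \sum_a \sum_b \sum_k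
      (u *m E) 0 a * christoffel i x0 k a b * (u *m E) 0 b * partial k (f w') x0.
    rewrite dir1E.
    transitivity (\sum_k \sum_a \sum_b
        (u *m E) 0 a * christoffel i x0 k a b * (u *m E) 0 b * partial k (f w') x0).
      apply: eq_bigr => k _; rewrite mxE mulr_suml; apply: eq_bigr => a _.
      by rewrite mulr_suml.
    rewrite exchange_big; apply: eq_bigr => a _; exact: exchange_big.
  rewrite quad_conj quadE bilE dir2E mulN1r cE -sumrB; apply: eq_bigr => a _.
  rewrite -sumrB; apply: eq_bigr => b _.
  rewrite [X in _ * X * _ = _]mxE [X in _ = _ * X - _]mxE mulrBr mulrBl.
  congr (_ - _); first by rewrite mulrAC.
  by rewrite mulr_sumr mulr_suml; apply: eq_bigr => k _; ring.
have D2' := L2Z (-1) D2.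
rewrite (regremD oU Ux0 fC2 mf vf _ _ Q2 D2') (regremZ oU Ux0 fC2 mf vf)//.
by rewrite (regrem_dir1 oU Ux0 fC2 mf vf varf frame_unit)// mulr0 addr0.
Qed.

(** The Levi-Civita connection is torsion-free: the first two terms are exchanged,
and the third one inherits the symmetry of the metric. *)
Lemma christoffel_sym k a b : christoffel i x0 k a b = christoffel i x0 k b a.
Proof.
rewrite /christoffel; congr (_ * _); apply: eq_bigr => l _; congr (_ * _).
rewrite [X in X - _]addrC; congr (_ - _).
have [dg _] := metric_C1 l Ux0.
have q_cvg p q : h^-1 * (metric i (h *: delta_mx 0 l + x0) p q - metric i x0 p q)
    @[h --> (0 : R)^'] --> (partial l (metric i) x0 p q : R).
  have cD : h^-1 *: ((metric i \o shift x0) (h *: delta_mx 0 l) - metric i x0)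
      @[h --> (0 : R)^'] --> partial l (metric i) x0 by exact: dg.
  have := cvg_comp _ _ cD (@coord_continuous R d d p q _).
  by apply: cvg_trans; apply: near_eq_cvg; apply: nearW => h /=; rewrite !mxE.
apply: cvg_unique (q_cvg a b) _ => //=.
apply: cvg_trans (q_cvg b a); apply: near_eq_cvg.
have symU x : U x -> metric i x a b = metric i x b a.
  by move=> Ux; rewrite -[in LHS](Defs.metric_sym Ux) mxE.
have [del del0 delP] := open_nbhs0 oU Ux0.
near=> h; rewrite (symU _ Ux0) symU//= addrC; apply: delP.
apply: le_lt_trans (_ : `|h| < del); last by near: h; exact: dnbhs0_lt.
by rewrite normrZ ler_piMr// norm_delta_le.
Unshelve. all: by end_near. Qed.

Lemma hessE_sym w : (hessE w)^T = hessE w.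
Proof.
rewrite /hessE !trmx_mul trmxK mulmxA; congr (_ *m _ *m _).
apply/matrixP => a b; rewrite [LHS]mxE [LHS]mxE [RHS]mxE.
have /matrixP/(_ a b) := hessm_sym oU (fC2 w) Ux0.
rewrite [LHS]mxE [LHS]mxE [RHS]mxE => ->; congr +%R; congr -%R.
by apply: eq_bigr => k _; rewrite christoffel_sym.
Qed.

Lemma Rtilde_sym w : ~ N w -> (Rtilde X F w)^T = Rtilde X F w.
Proof.
move=> Nw; apply/matrixP => k l; rewrite [LHS]mxE !Rtilde_off//.
congr regrem; apply/funext => w'.
by rewrite -[in LHS]hessE_sym mxE.
Qed.

(** The local approximation behind both limits. The point [s] is constrained
through its coordinates only, so that the statement may be used along curves as
well as for all points near [t]. *)
Lemma Xbar_near w : ~ N w -> forall eps : R, 0 < eps ->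
  \forall u \near (0 : 'rV[R]_d), u != 0 ->
  forall s, dom i s -> Defs.coord i s = x0 + u *m E ->
  `|Xbar X F s w - quad (Rtilde X F w) u / quad (Lambda2 X F) u| <= eps.
Proof.
move=> Nw eps eps0.
have oN : is_o2 (fun u => regrem P x0 f E (fun w => f w (x0 + u *m E)) w
    - 2^-1 * quad (Rtilde X F w) u).
  have := is_o2_mulmx E (numerator_o2 oU Ux0 fC2 mf vf varf frame_unit Lamunit w).
  by congr is_o2; apply/funext => u; rewrite quad_Rtilde.
have oD : is_o2 (fun u => (1 - ip (fun w => f w (x0 + u *m E)) (fun w => f w x0))
    - 2^-1 * quad (Lambda2 X F) u).
  have := is_o2_mulmx E (denominator_o2 oU Ux0 fC2 mf vf varf).
  by congr is_o2; apply/funext => u; rewrite (ip_dir1_dir1 oU Ux0 fC2 mf vf) Lambda2E.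
have := ratio_near Lambda2_psd Lunit oN oD eps0.
apply: filterS => u H u0 s ds su; rewrite Xbar_off// su; exact: H.
Qed.

End field_at_point.

(** * Limits at a point *)

Lemma cvg_mulmx (R : realType) (d : nat) (I : Type) (G : set_system I)
    {FG : Filter G} (v : I -> 'rV[R]_d) (l : 'rV[R]_d) (B : 'M[R]_d) :
  v x @[x --> G] --> l -> v x *m B @[x --> G] --> l *m B.
Proof.
move=> vl; have [C C0 CB] := mulmx_norm_le B.
apply/cvgrPdistC_le => e e0; have eC : 0 < e / C by rewrite divr_gt0.
near=> x; rewrite -mulmxBl (le_trans (CB _))// mulrC -ler_pdivlMr//.
by near: x; move/cvgrPdistC_le : vl; apply.
Unshelve. all: by end_near. Qed.

Section limits_at_point.
Context {R : realType} {d : nat} {M : topologicalType} {A : riemannian R d M}.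
Context {dT : measure_display} {T : measurableType dT} (P : probability T R).
Context {X : M -> {RV P >-> R}} (N : set T).
Hypotheses (mN : measurable N) (N0 : P N = 0%E)
  (NC2 : forall w, ~ N w -> C2_map A (fun p => X p w)).
Hypotheses (Xgaussian : gaussian_field X)
  (Xmean : forall p, ('E_P[X p] = 0)%E) (Xvar : forall p, ('V_P[X p] = 1)%E).
Context {t : M} (F : frame A t).
Hypothesis Lunit : Lambda2 X F \in unitmx.
Let i := frame_chart F.
Let E := frame_mx F.
Let x0 := Defs.coord i t.
Let S := sqrtmx (Lambda2 X F).
Variable w : T.
Hypothesis Nw : ~ N w.

Let Lpsd : psdmx (Lambda2 X F).
Proof. exact: (Lambda2_psd mN N0 NC2 Xgaussian Xmean Xvar F). Qed.

Let near_u := Xbar_near mN N0 NC2 Xgaussian Xmean Xvar Lunit Nw.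

(** The ratio of quadratic forms is homogeneous of degree zero, so [u r] may be
replaced by [r^-1 *: u r], which has a nonzero limit. *)
Lemma Xbar_curve (s : R -> M) (u : R -> 'rV[R]_d) (u0 : 'rV[R]_d) : u0 != 0 ->
  (\forall r \near (0 : R)^', dom i (s r) /\ Defs.coord i (s r) = x0 + u r *m E) ->
  r^-1 *: u r @[r --> (0 : R)^'] --> u0 ->
  Xbar X F (s r) w @[r --> (0 : R)^'] -->
    quad (Rtilde X F w) u0 / quad (Lambda2 X F) u0.
Proof.
move=> u00 su cu.
have L0 : quad (Lambda2 X F) u0 != 0 by rewrite gt_eqF// quad_gt0.
have cr : quad (Rtilde X F w) (r^-1 *: u r) / quad (Lambda2 X F) (r^-1 *: u r)
    @[r --> (0 : R)^'] --> quad (Rtilde X F w) u0 / quad (Lambda2 X F) u0.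
  apply: cvgM; first exact: cvg_comp cu (@continuous_bil _ _ (Rtilde X F w) u0).
  by apply: cvgV => //; exact: cvg_comp cu (@continuous_bil _ _ (Lambda2 X F) u0).
have u_cvg0 : u r @[r --> (0 : R)^'] --> (0 : 'rV[R]_d).
  have : r *: (r^-1 *: u r) @[r --> (0 : R)^'] --> 0 *: u0.
    by apply: cvgZ => //; apply: cvg_within_filter; exact: cvg_id.
  rewrite scale0r; apply: cvg_trans; apply: near_eq_cvg; near=> r.
  rewrite scalerA divff ?scale1r//; near: r; exact: nbhs_dnbhs_neq.
apply/cvgrPdistC_le => e e0; have e2 : 0 < e / 2 by rewrite divr_gt0.
near=> r.
have r0 : r != 0 by near: r; exact: nbhs_dnbhs_neq.
have ru0 : r^-1 *: u r != 0.
  have : `|r^-1 *: u r - u0| < `|u0|.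
    by near: r; apply: (cvgrPdistC_lt _ _).1 => //; rewrite normr_gt0.
  by apply: contraTneq => ->; rewrite sub0r normrN ltxx.
have ur0 : u r != 0 by apply: contraNneq ru0 => ->; rewrite scaler0.
have [ds cs] : dom i (s r) /\ Defs.coord i (s r) = x0 + u r *m E by near: r.
have h1 : `|Xbar X F (s r) w - quad (Rtilde X F w) (u r) / quad (Lambda2 X F) (u r)|
    <= e / 2.
  by move: ur0 (s r) ds cs; near: r; exact: u_cvg0 _ (near_u e2).
have h2 : `|quad (Rtilde X F w) (u r) / quad (Lambda2 X F) (u r)
    - quad (Rtilde X F w) u0 / quad (Lambda2 X F) u0| <= e / 2.
  have <- : quad (Rtilde X F w) (r^-1 *: u r) / quad (Lambda2 X F) (r^-1 *: u r) =
      quad (Rtilde X F w) (u r) / quad (Lambda2 X F) (u r).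
    have Lr : quad (Lambda2 X F) (u r) != 0 by rewrite gt_eqF// quad_gt0.
    by rewrite !quadZ; field; rewrite Lr r0.
  by near: r; exact: (cvgrPdistC_le _ _).1.
rewrite (splitr e); apply: le_trans (lerD h1 h2).
by rewrite -[X in `|X| <= _](subrKA (quad (Rtilde X F w) (u r) / quad (Lambda2 X F) (u r)))
  ler_normD.
Unshelve. all: by end_near. Qed.

Lemma coord_displacement_cvg :
  (Defs.coord i s - x0) *m invmx E @[s --> t] --> (0 : 'rV[R]_d).
Proof.
rewrite -(mul0mx _ (invmx E)) -[X in X *m _](subrr x0).
apply: cvg_mulmx; apply: cvgB; last exact: cvg_cst.
by apply: Defs.coord_continuous; exact: frame_dom.
Qed.

(** Up to an arbitrarily small error, X^{|t}(s) is the value of the quadratic form in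
the direction of the displacement of [s], which gives the upper bound. For the lower bound, X^{|t} is
followed along the coordinate line whose direction is mapped to [h0] by [S]. *)
Lemma limsup_Xbar h0 : norm2 h0 = 1 ->
  (forall u, quad (Rmx X F w) u <= quad (Rmx X F w) h0 * norm2 u ^+ 2) ->
  limf_esup (fun s => (Xbar X F s w)%:E) t^' = (quad (Rmx X F w) h0)%:E.
Proof.
move=> h01 maxh0; set L := quad _ h0.
have Sunit := sqrtmx_unit Lpsd Lunit.
have Eunit : E \in unitmx := frame_unit F.
have dU : \forall s \near t, dom i s.
  exact: open_nbhs_nbhs (conj (dom_open i) (frame_dom F)).
apply/eqP; rewrite eq_le limf_esupE; apply/andP; split.
  apply/lee_addgt0Pr => e e0.
  have near_s : \forall s \near t, s != t -> Xbar X F s w <= L + e.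
    pose phi s := (Defs.coord i s - x0) *m invmx E.
    have phi_near : \forall s \near t, phi s != 0 -> forall p, dom i p ->
        Defs.coord i p = x0 + phi s *m E ->
        `|Xbar X F p w - quad (Rtilde X F w) (phi s) / quad (Lambda2 X F) (phi s)| <= e.
      exact: coord_displacement_cvg (near_u e0).
    near=> s => st.
    have ds : dom i s by near: s.
    have us : Defs.coord i s = x0 + phi s *m E by rewrite mulmxKV// addrC subrK.
    have u0 : phi s != 0.
      apply: contra_neq st => u0; rewrite -(coordK ds) us u0 mul0mx addr0.
      by rewrite coordK//; exact: frame_dom.
    have : `|Xbar X F s w
        - quad (Rtilde X F w) (phi s) / quad (Lambda2 X F) (phi s)| <= e.
      have Hs : phi s != 0 -> forall p, dom i p ->
        Defs.coord i p = x0 + phi s *m E ->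
        `|Xbar X F p w - quad (Rtilde X F w) (phi s) / quad (Lambda2 X F) (phi s)| <= e.
        by near: s.
      exact: Hs.
    rewrite (quad_ratio Lpsd Lunit) => /(le_trans (ler_norm _)).
    rewrite lerBlDl => /le_trans; apply; rewrite lerD2r (le_trans (maxh0 _))//.
    rewrite norm2_normalize ?expr1n ?mulr1//.
    by apply: contra_neq u0 => uS; rewrite -(mulmxK Sunit (phi s)) uS mul0mx.
  apply: (@le_trans _ _ (ereal_sup ((fun s => (Xbar X F s w)%:E) @`
      [set s | Xbar X F s w <= L + e]))).
    by apply: ereal_inf_lbound; exists [set s | Xbar X F s w <= L + e].
  by apply: ge_ereal_sup => _ [s /= sL <-]; rewrite lee_fin.
apply: le_ereal_inf_tmp => _ [V tV <-].
pose u0 := h0 *m invmx S.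
have u0S : u0 *m S = h0 by rewrite mulmxKV.
have u0_neq0 : u0 != 0.
  have : h0 != 0 by rewrite -norm2_eq0 h01 oner_eq0.
  by apply: contra_neq => u00; rewrite -u0S u00 mul0mx.
pose s (r : R) := param i (x0 + r *: u0 *m E).
have line_cvg : x0 + r *: u0 *m E @[r --> (0 : R)] --> x0.
  rewrite -[X in _ --> X]addr0 -(mul0mx _ E) -(scale0r u0).
  apply: cvgD; first exact: cvg_cst.
  by apply: cvg_mulmx; apply: cvgZr_tmp; exact: cvg_id.
have Ux0 : (Defs.coord i @` dom i) x0 by exists t => //; exact: frame_dom.
have near_line : \forall r \near (0 : R),
    (Defs.coord i @` dom i) (x0 + r *: u0 *m E).
  by apply: line_cvg; apply: open_nbhs_nbhs; split => //; exact: img_open.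
have s_dom : \forall r \near (0 : R)^',
    dom i (s r) /\ Defs.coord i (s r) = x0 + r *: u0 *m E.
  apply: nbhs_dnbhs; apply: filterS near_line => r [p dp pE].
  by rewrite /s -pE coordK.
have param0 : param i x0 = t by apply: coordK; exact: frame_dom.
have s_cvg : s r @[r --> (0 : R)] --> t.
  by rewrite -[X in _ --> X]param0; exact: cvg_comp line_cvg (param_continuous Ux0).
have cX : Xbar X F (s r) w @[r --> (0 : R)^'] --> L.
  have <- : quad (Rtilde X F w) u0 / quad (Lambda2 X F) u0 = L.
    by rewrite (quad_ratio Lpsd Lunit) u0S h01 invr1 scale1r.
  apply: (Xbar_curve u0_neq0 s_dom).
  apply: cvg_near_cst; near=> r.
  rewrite scalerA mulVf ?scale1r//; near: r; exact: nbhs_dnbhs_neq.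
apply/lee_addgt0Pr => e e0.
have near_V : \forall r \near (0 : R)^', V (s r).
  have nV : \forall r \near (0 : R)^', s r != t -> V (s r).
    by apply: nbhs_dnbhs; exact: s_cvg _ tV.
  near=> r; have : s r != t -> V (s r) by near: r.
  apply; have r0 : r != 0 by near: r; exact: nbhs_dnbhs_neq.
  have [_ cs] : dom i (s r) /\ Defs.coord i (s r) = x0 + r *: u0 *m E by near: r.
  apply: contra_neq u0_neq0 => st.
  have : r *: u0 *m E = 0.
    by apply: (addrI x0); rewrite -cs st addr0.
  move=> /(congr1 (mulmx^~ (invmx E))); rewrite mulmxK// mul0mx => /eqP.
  by rewrite scaler_eq0 (negbTE r0) => /eqP.
have near_X : \forall r \near (0 : R)^', `|L - Xbar X F (s r) w| <= e.
  by move/cvgrPdist_le : cX; apply.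
have [r [Vr Xr]] : exists r, V (s r) /\ `|L - Xbar X F (s r) w| <= e.
  by near ((0 : R)^') => r; exists r; split; near: r.
apply: (@le_trans _ _ ((Xbar X F (s r) w)%:E + e%:E)%E).
  by rewrite -EFinD lee_fin; have := ler_norm (L - Xbar X F (s r) w); lra.
by apply: leeD2r; apply: ereal_sup_ubound; exists (s r).
Unshelve. all: by end_near. Qed.

Lemma exp_map_limit (e : 'rV[R]_d -> M) (h : 'rV[R]_d) :
  is_exp_map F e -> h != 0 ->
  Xbar X F (e (eps *: h)) w @[eps --> (0 : R)^'] -->
    quad (Rtilde X F w) h / quad (Lambda2 X F) h.
Proof.
move=> eexp h0; pose g (r : R) := e (r *: h).
have [[g_cont g_geo] g_0 dg] := eexp h; have g0 : g 0 = t := g_0.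
have Eunit : E \in unitmx := frame_unit F.
have dg0 : dom i (g 0) by rewrite g0; exact: frame_dom.
have [derx _ _] := g_geo i (0 : R) dg0.
pose u (r : R) := (Defs.coord i (g r) - x0) *m invmx E.
apply: (@Xbar_curve g u) => //.
  have dn : \forall r \near (0 : R), dom i (g r).
    by apply: g_cont; apply: open_nbhs_nbhs; split => //; exact: dom_open.
  apply: nbhs_dnbhs; apply: filterS dn => r dr; split => //.
  by rewrite /u mulmxKV// addrC subrK.
have cD : r^-1 *: (((Defs.coord i \o g) \o shift 0) (r *: 1) - (Defs.coord i \o g) 0)
    @[r --> (0 : R)^'] --> h *m E.
  by rewrite -dg derive1E; exact: derx.
have cE := cvg_mulmx (B := invmx E) cD; rewrite mulmxK// in cE.
have uE : (fun r => r^-1 *: u r) = fun r => (r^-1 *: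
    (((Defs.coord i \o g) \o shift 0) (r *: 1) - (Defs.coord i \o g) 0)) *m invmx E.
  apply/funext => r; rewrite /= g0 addr0 -scalemxAl.
  congr (_ *: ((Defs.coord i (g _) - _) *m _)).
  by rewrite [RHS]mulr1.
by rewrite uE; exact: cE.
Qed.

End limits_at_point.

Unset Implicit Arguments.
Set Strict Implicit.

Theorem lemma3 (R : realType) (d : nat) (M : topologicalType)
    (A : riemannian R d M)
    (Mcompact : compact [set: M]) (Mhausdorff : hausdorff_space M)
    (dT : measure_display) (T : measurableType dT) (P : probability T R)
    (X : M -> {RV P >-> R})
    (Xgaussian : gaussian_field X)
    (XC2 : {ae P, forall w, C2_map A (fun p => X p w)})
    (Xmean : forall p, ('E_P[X p] = 0)%E)
    (Xvar : forall p, ('V_P[X p] = 1)%E)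
    (Xnondeg : forall p (F : frame A p), Lambda2 X F \in unitmx)
    (t : M) (F : frame A t)
    (e : 'rV[R]_d -> M) (eexp : is_exp_map F e)
    (h : 'rV[R]_d) (h_neq0 : h != 0) :
  {ae P, forall w,
    let htilde := h *m sqrtmx (Lambda2 X F) in
    Xbar X F (e (eps *: h)) w @[eps --> (0 : R)^'] -->
      quad (Rtilde X F w) h / quad (Lambda2 X F) h /\
    quad (Rtilde X F w) h / quad (Lambda2 X F) h =
      quad (Rmx X F w) ((norm2 htilde)^-1 *: htilde)} /\
  {ae P, forall w, exists h0 : 'rV[R]_d,
    [/\ norm2 h0 = 1,
        limf_esup (fun s => (Xbar X F s w)%:E) t^' = (quad (Rmx X F w) h0)%:E,
        is_lambda_max (Rmx X F w) (quad (Rmx X F w) h0) &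
        (limf_esup (fun s => (Xbar X F s w)%:E) t^' < +oo)%E]}.
Proof.
have [N [mN N0 NC2']] := XC2.
have NC2 w : ~ N w -> C2_map A (fun p => X p w).
  by move=> Nw; apply: contrapT => C2w; apply: Nw; exact: NC2'.
have Lunit := Xnondeg t F.
have Lpsd := Lambda2_psd mN N0 NC2 Xgaussian Xmean Xvar F.
split; exists N; split => // w; apply: contra_notP => Nw.
  split; last exact: quad_ratio Lpsd Lunit _ _.
  exact: (exp_map_limit mN N0 NC2 Xgaussian Xmean Xvar Lunit Nw eexp h_neq0).
have d0 : (0 < d)%N.
  rewrite lt0n; apply: contra_neq h_neq0 => d0.
  by apply/rowP => j; have := ltn_ord j; rewrite [X in (_ < X)%N]d0.
have [h0 h01 maxh0] := exists_quad_max (Rmx X F w) d0.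
have Rsym : (Rmx X F w)^T = Rmx X F w.
  rewrite /Rmx !trmx_mul trmx_inv (sqrtmx_sym Lpsd).
  by rewrite (Rtilde_sym mN N0 NC2 Xgaussian Xmean Xvar Lunit Nw) mulmxA.
have esup := limsup_Xbar mN N0 NC2 Xgaussian Xmean Xvar Lunit Nw h01 maxh0.
exists h0; split => //; first exact: quad_max_lambda_max.
by rewrite esup ltry.
Qed.
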